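(* Let $z_0\in\Delta\setminus\{0\}$ and let $c\in\mathbb R$ with $0\le c<\frac{1}{16(1+\varepsilon)^3}$. Then every infinitesimal extremal disc for the pair $\big((0,0),(1,cz_0)\big)$ in $\Omega$ is a complex geodesic and an infinitesimal complex geodesic of $\Omega$.
   Context: $\Delta$ denotes the unit disc in $\mathbb C$ and $\Delta_r$ the disc of radius $r$ centered at $0$. Fix $0<\varepsilon<\frac{1}{100}$. Let $\rho(z,w)=|z|^2+|w|^2-\operatorname{Re}(\bar z^4w^2)-1$ on $\mathbb C^2$, and $\Omega=\{\rho<0\}\cap\big(\Delta_{1+\varepsilon}\times\Delta_{\frac{1}{4(1+\varepsilon)^3}}\big)$. A holomorphic $f:\Delta\to\Omega$ is an infinitesimal extremal disc for $(p,v)$ if $f(0)=p$, $f'(0)=\lambda v$ with $\lambda>0$, and for every holomorphic $g:\Delta\to\Omega$ with $g(0)=p$, $g'(0)=\mu v$, $\mu>0$, one has $\mu\le\lambda$. It is a complex geodesic if $d_\Omega(f(\zeta),f(\zeta'))=d_\Delta(\zeta,\zeta')$ for all $\zeta,\zeta'\in\Delta$, and an infinitesimal complex geodesic if $K_\Omega(f(\zeta),d_\zeta f(v_0))=K_\Delta(\zeta,v_0)$ for all $\zeta\in\Delta$, $v_0\in\mathbb C$ ($K,d$ the Kobayashi metric and distance; on $\Delta$ the Poincaré ones). *)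

(* Defs.v *)
From Stdlib Require Import Reals List.
Open Scope R_scope.

Definition Cx : Type := (R * R)%type.
Definition RtoC (x : R) : Cx := (x, 0).
Definition Cadd (z w : Cx) : Cx := (fst z + fst w, snd z + snd w).
Definition Copp (z : Cx) : Cx := (- fst z, - snd z).
Definition Csub (z w : Cx) : Cx := Cadd z (Copp w).
Definition Cmul (z w : Cx) : Cx :=
  (fst z * fst w - snd z * snd w, fst z * snd w + snd z * fst w).
Definition Cconj (z : Cx) : Cx := (fst z, - snd z).
Definition Cmod (z : Cx) : R := sqrt (fst z ^ 2 + snd z ^ 2).
Definition Cre (z : Cx) : R := fst z.
Definition Czero : Cx := (0, 0).
Definition Cone : Cx := (1, 0).

Definition in_disc_r (r : R) (z : Cx) : Prop := Cmod z < r.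
Definition in_disc (z : Cx) : Prop := in_disc_r 1 z.

Definition has_cderiv (f : Cx -> Cx) (z l : Cx) : Prop :=
  forall eps : R, 0 < eps -> exists delta : R, 0 < delta /\
    forall h : Cx, 0 < Cmod h < delta ->
      Cmod (Csub (Csub (f (Cadd z h)) (f z)) (Cmul l h)) <= eps * Cmod h.

Definition deriv2 (F : Cx -> Cx * Cx) (z : Cx) (l : Cx * Cx) : Prop :=
  has_cderiv (fun t => fst (F t)) z (fst l) /\
  has_cderiv (fun t => snd (F t)) z (snd l).

Definition holo_map (Om : Cx * Cx -> Prop) (F : Cx -> Cx * Cx) : Prop :=
  (forall z, in_disc z -> Om (F z)) /\
  (forall z, in_disc z -> exists l, deriv2 F z l).

Definition Cscal (a : Cx) (v : Cx * Cx) : Cx * Cx := (Cmul a (fst v), Cmul a (snd v)).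

Definition is_glb (S : R -> Prop) (m : R) : Prop :=
  (forall x, S x -> m <= x) /\ (forall m', (forall x, S x -> m' <= x) -> m' <= m).

Definition poincare_dist (a b : Cx) : R :=
  let t := Cmod (Csub a b) / Cmod (Csub Cone (Cmul (Cconj a) b)) in
  / 2 * ln ((1 + t) / (1 - t)).
Definition poincare_metric (z v : Cx) : R := Cmod v / (1 - Cmod z ^ 2).

Definition kob_metric (Om : Cx * Cx -> Prop) (p v : Cx * Cx) (r : R) : Prop :=
  is_glb (fun x => exists (F : Cx -> Cx * Cx) (a : Cx) (l : Cx * Cx),
            holo_map Om F /\ F Czero = p /\ deriv2 F Czero l /\ Cscal a l = v /\
            x = Cmod a) r.

Fixpoint kob_chain (Om : Cx * Cx -> Prop) (p q : Cx * Cx)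
  (L : list ((Cx -> Cx * Cx) * Cx * Cx)) : Prop :=
  match L with
  | nil => p = q
  | (F, a, b) :: L' =>
      holo_map Om F /\ in_disc a /\ in_disc b /\ F a = p /\ kob_chain Om (F b) q L'
  end.

Fixpoint chain_length (L : list ((Cx -> Cx * Cx) * Cx * Cx)) : R :=
  match L with
  | nil => 0
  | (_, a, b) :: L' => poincare_dist a b + chain_length L'
  end.

Definition kob_dist (Om : Cx * Cx -> Prop) (p q : Cx * Cx) (r : R) : Prop :=
  is_glb (fun x => exists L, kob_chain Om p q L /\ x = chain_length L) r.

Definition rho (P : Cx * Cx) : R :=
  let z := fst P in let w := snd P in
  Cmod z ^ 2 + Cmod w ^ 2
  - Cre (Cmul (Cmul (Cmul (Cconj z) (Cconj z)) (Cmul (Cconj z) (Cconj z)))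
              (Cmul w w)) - 1.

Definition Omega (eps : R) (P : Cx * Cx) : Prop :=
  rho P < 0 /\ in_disc_r (1 + eps) (fst P) /\
  in_disc_r (/ (4 * (1 + eps) ^ 3)) (snd P).

Definition inf_extremal (Om : Cx * Cx -> Prop) (p v : Cx * Cx) (F : Cx -> Cx * Cx) : Prop :=
  holo_map Om F /\ F Czero = p /\
  exists lam, 0 < lam /\ deriv2 F Czero (Cscal (RtoC lam) v) /\
  forall (G : Cx -> Cx * Cx) (mu : R),
    holo_map Om G -> G Czero = p -> 0 < mu -> deriv2 G Czero (Cscal (RtoC mu) v) ->
    mu <= lam.

Definition complex_geodesic (Om : Cx * Cx -> Prop) (F : Cx -> Cx * Cx) : Prop :=
  holo_map Om F /\
  forall z z', in_disc z -> in_disc z' -> kob_dist Om (F z) (F z') (poincare_dist z z').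

(* d_z F (v0) = F'(z) v0 *)
Definition inf_complex_geodesic (Om : Cx * Cx -> Prop) (F : Cx -> Cx * Cx) : Prop :=
  holo_map Om F /\
  forall z v0 l, in_disc z -> deriv2 F z l ->
    kob_metric Om (F z) (Cscal v0 l) (poincare_metric z v0).

(* Main.v *)
From Pilot Require Import Defs.
From Stdlib Require Import Reals List Lra Classical ClassicalEpsilon.
From Coquelicot Require Import Coquelicot.
Open Scope R_scope.

(* The bounds on [z] and [w] force [|z| < 1] on Omega, so the first projection maps
   Omega to the unit disc.  For [b = c z0] the disc [t |-> (t, b t + conj b t^3)] lies
   in Omega and has derivative [(1, b)] at 0; hence an extremal disc [F] has
   [lam >= 1], and the Schwarz lemma applied to [fst o F] gives [lam = 1] and
   [fst o F = id].  A disc with a holomorphic left inverse is a geodesic by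
   Schwarz-Pick.

   Only pointwise complex differentiability is assumed, so the Schwarz lemma is
   derived from Goursat's bisection argument in the coordinates [z = exp (s + i t)],
   which yields the mean value property of [f z / z] at 0.  The finite Schwarz-Pick
   inequality is obtained by integrating the infinitesimal one along a radius; in the
   form [artanh (Re (h b)) - artanh (Re (h a)) <= d a b] it telescopes along Kobayashi
   chains, so the triangle inequality for the Poincare distance is not needed. *)

(** * Goursat's theorem *)

(** Serves for two opposite sides of a rectangle, whose integrands differ by nearly the constant
    [c], and, with [g = 0], for comparing a circle integral with a constant. *)
Lemma RInt_sub_const_bound (f g : R -> R) (x h c M : R) :
  0 <= h -> ex_RInt f x (x + h) -> ex_RInt g x (x + h) ->
  (forall s, x <= s <= x + h -> Rabs (f s - g s - c) <= M) ->
  Rabs (RInt f x (x + h) - RInt g x (x + h) - h * c) <= h * M.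
Proof.
intros Hh If Ig H.
replace (RInt f x (x + h) - RInt g x (x + h) - h * c)
  with (RInt (fun s => f s - g s - c) x (x + h)).
- replace h with (x + h - x) at 2 by ring.
  apply abs_RInt_le_const; [lra | | exact H].
  apply (ex_RInt_minus (V := R_NormedModule) (fun s => f s - g s) (fun _ => c)).
  + apply (ex_RInt_minus (V := R_NormedModule) f g); assumption.
  + apply ex_RInt_const.
- rewrite (RInt_minus (V := R_CompleteNormedModule) (fun s => f s - g s) (fun _ => c)).
  + rewrite (RInt_minus (V := R_CompleteNormedModule) f g) by assumption.
    rewrite RInt_const. unfold minus, plus, opp, scal; simpl. unfold mult; simpl. ring.
  + apply (ex_RInt_minus (V := R_NormedModule) f g); assumption.
  + apply ex_RInt_const.
Qed.

(** This is the counterclockwise boundary integral of [P dx + Q dy] over the rectangle with lower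
    left corner [(x, y)] and sides [h], [k]. *)
Definition circulation (P Q : R -> R -> R) (x y h k : R) : R :=
  RInt (fun s => P s y) x (x + h) - RInt (fun s => P s (y + k)) x (x + h)
  + (RInt (Q (x + h)) y (y + k) - RInt (Q x) y (y + k)).

(** The shared coefficient [b] encodes [dP/dy = dQ/dx]. It is a condition at a single point and asks
    nothing about continuity of the partial derivatives. *)
Definition closed_form_at (P Q : R -> R -> R) (x y : R) : Prop :=
  exists a b c, differentiable_pt_lim P x y a b /\ differentiable_pt_lim Q x y b c.

Lemma differentiable_pt_lim_continuity (f : R -> R -> R) (x y a b : R) :
  differentiable_pt_lim f x y a b -> continuity_2d_pt f x y.
Proof. intros H. apply differentiable_continuity_pt. now exists a, b. Qed.

Lemma continuity_2d_pt_row (f : R -> R -> R) (x y : R) :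
  continuity_2d_pt f x y -> continuous (f x) y.
Proof.
intros H. apply continuity_pt_filterlim. intros eps Heps.
destruct (H (mkposreal eps Heps)) as [d Hd]. exists d. split; [apply d | ].
intros v [_ Hv]. apply Hd; [ | exact Hv].
replace (x - x) with 0 by ring. rewrite Rabs_R0. apply d.
Qed.

Lemma continuity_2d_pt_col (f : R -> R -> R) (x y : R) :
  continuity_2d_pt f x y -> continuous (fun s => f s y) x.
Proof.
intros H. apply continuity_pt_filterlim. intros eps Heps.
destruct (H (mkposreal eps Heps)) as [d Hd]. exists d. split; [apply d | ].
intros v [_ Hv]. apply Hd; [exact Hv | ].
replace (y - y) with 0 by ring. rewrite Rabs_R0. apply d.
Qed.

Section Goursat.

Variables (P Q : R -> R -> R) (x0 y0 h0 k0 : R).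
Hypothesis Hcl : forall x y, x0 <= x <= x0 + h0 -> y0 <= y <= y0 + k0 -> closed_form_at P Q x y.

Lemma ex_RInt_P y a b : x0 <= a <= b -> b <= x0 + h0 -> y0 <= y <= y0 + k0 ->
  ex_RInt (fun s => P s y) a b.
Proof.
intros Ha Hb Hy. apply (ex_RInt_continuous (V := R_CompleteNormedModule)).
intros z. rewrite Rmin_left, Rmax_right by lra. intros Hz.
destruct (Hcl z y) as (a' & b' & c' & H1 & H2); try lra.
apply continuity_2d_pt_col. eapply differentiable_pt_lim_continuity; eassumption.
Qed.

Lemma ex_RInt_Q x a b : y0 <= a <= b -> b <= y0 + k0 -> x0 <= x <= x0 + h0 ->
  ex_RInt (Q x) a b.
Proof.
intros Ha Hb Hy. apply (ex_RInt_continuous (V := R_CompleteNormedModule)).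
intros z. rewrite Rmin_left, Rmax_right by lra. intros Hz.
destruct (Hcl x z) as (a' & b' & c' & H1 & H2); try lra.
apply continuity_2d_pt_row. eapply differentiable_pt_lim_continuity; eassumption.
Qed.

(** Each inner side is traversed twice in opposite directions, so only the outer boundary survives
    in the sum. *)
Lemma circulation_split x y h k :
  0 <= h -> 0 <= k -> x0 <= x -> x + h <= x0 + h0 -> y0 <= y -> y + k <= y0 + k0 ->
  circulation P Q x y h k =
  circulation P Q x y (h / 2) (k / 2) + circulation P Q (x + h / 2) y (h / 2) (k / 2)
  + (circulation P Q x (y + k / 2) (h / 2) (k / 2)
     + circulation P Q (x + h / 2) (y + k / 2) (h / 2) (k / 2)).
Proof.
intros Hh Hk Hx Hxh Hy Hyk. unfold circulation.
replace (x + h / 2 + h / 2) with (x + h) by field.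
replace (y + k / 2 + k / 2) with (y + k) by field.
assert (CP : forall u, y0 <= u <= y0 + k0 -> RInt (fun s => P s u) x (x + h)
  = RInt (fun s => P s u) x (x + h / 2) + RInt (fun s => P s u) (x + h / 2) (x + h)).
{ intros u Hu. symmetry.
  apply (RInt_Chasles (V := R_CompleteNormedModule) (fun s => P s u)); apply ex_RInt_P; lra. }
assert (CQ : forall u, x0 <= u <= x0 + h0 -> RInt (Q u) y (y + k)
  = RInt (Q u) y (y + k / 2) + RInt (Q u) (y + k / 2) (y + k)).
{ intros u Hu. symmetry.
  apply (RInt_Chasles (V := R_CompleteNormedModule) (Q u)); apply ex_RInt_Q; lra. }
rewrite !CP, !CQ by lra. ring.
Qed.

(** The first-order parts of [P] and [Q] at [(u, v)] contribute [- h b k] and [k b h], which cancel.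
    The remainders are at most [eps / 2 * (h + k)] on all four sides, of total length
    [2 (h + k)]. *)
Lemma circulation_local (eps u v : R) : 0 < eps ->
  x0 <= u <= x0 + h0 -> y0 <= v <= y0 + k0 ->
  exists delta, 0 < delta /\ forall x y h k,
    0 <= h < delta -> 0 <= k < delta -> x <= u <= x + h -> y <= v <= y + k ->
    x0 <= x -> x + h <= x0 + h0 -> y0 <= y -> y + k <= y0 + k0 ->
    Rabs (circulation P Q x y h k) <= eps * (h + k) ^ 2.
Proof.
intros Heps Hu Hv.
destruct (Hcl u v Hu Hv) as (a & b & c & DP & DQ).
assert (He2 : 0 < eps / 2) by lra.
destruct (DP (mkposreal _ He2)) as [d1 H1]. destruct (DQ (mkposreal _ He2)) as [d2 H2].
simpl in H1, H2.
exists (Rmin d1 d2). split; [apply Rmin_pos; [apply d1 | apply d2] | ].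
intros x y h k Hh Hk Hx Hy Bx Bxh By Byk.
assert (M1 := Rmin_l d1 d2). assert (M2 := Rmin_r d1 d2).
assert (mx : forall s t, x <= s <= x + h -> y <= t <= y + k ->
  Rabs (s - u) <= h /\ Rabs (t - v) <= k /\ Rmax (Rabs (s - u)) (Rabs (t - v)) <= h + k).
{ intros s t Hs Ht. assert (Rabs (s - u) <= h) by (apply Rabs_le; lra).
  assert (Rabs (t - v) <= k) by (apply Rabs_le; lra).
  repeat split; try assumption. apply Rmax_lub; lra. }
assert (EP : forall s t, x <= s <= x + h -> y <= t <= y + k ->
  Rabs (P s t - P u v - (a * (s - u) + b * (t - v))) <= eps / 2 * (h + k)).
{ intros s t Hs Ht. destruct (mx s t Hs Ht) as (m1 & m2 & m3).
  eapply Rle_trans; [apply H1; lra | apply Rmult_le_compat_l; lra]. }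
assert (EQ : forall s t, x <= s <= x + h -> y <= t <= y + k ->
  Rabs (Q s t - Q u v - (b * (s - u) + c * (t - v))) <= eps / 2 * (h + k)).
{ intros s t Hs Ht. destruct (mx s t Hs Ht) as (m1 & m2 & m3).
  eapply Rle_trans; [apply H2; lra | apply Rmult_le_compat_l; lra]. }
assert (IP : Rabs (RInt (fun s => P s y) x (x + h) - RInt (fun s => P s (y + k)) x (x + h)
   - h * (- (b * k))) <= h * (eps * (h + k))).
{ apply RInt_sub_const_bound; try lra; try (apply ex_RInt_P; lra).
  intros s Hs. assert (A1 := EP s y Hs ltac:(lra)). assert (A2 := EP s (y + k) Hs ltac:(lra)).
  apply Rabs_le_between in A1. apply Rabs_le_between in A2. apply Rabs_le. lra. }
assert (IQ : Rabs (RInt (Q (x + h)) y (y + k) - RInt (Q x) y (y + k)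
   - k * (b * h)) <= k * (eps * (h + k))).
{ apply RInt_sub_const_bound; try lra; try (apply ex_RInt_Q; lra).
  intros s Hs. assert (A1 := EQ x s ltac:(lra) Hs). assert (A2 := EQ (x + h) s ltac:(lra) Hs).
  apply Rabs_le_between in A1. apply Rabs_le_between in A2. apply Rabs_le. lra. }
unfold circulation.
apply Rabs_le_between in IP. apply Rabs_le_between in IQ. apply Rabs_le.
replace (eps * (h + k) ^ 2) with (h * (eps * (h + k)) + k * (eps * (h + k))) by ring. lra.
Qed.

(** Halving both sides divides [eps * (h + k) ^ 2] by 4, the number of quarters, so the bound cannot
    hold on all quarters and fail on the whole. *)
Lemma bisection_step (eps x y h k : R) :
  0 <= h -> 0 <= k -> x0 <= x -> x + h <= x0 + h0 -> y0 <= y -> y + k <= y0 + k0 ->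
  eps * (h + k) ^ 2 < Rabs (circulation P Q x y h k) ->
  exists p : R * R, (fst p = x \/ fst p = x + h / 2) /\ (snd p = y \/ snd p = y + k / 2) /\
  eps * (h / 2 + k / 2) ^ 2 < Rabs (circulation P Q (fst p) (snd p) (h / 2) (k / 2)).
Proof.
intros Hh Hk Hx Hxh Hy Hyk Big. apply NNPP. intros N.
assert (Small : forall u v, (u = x \/ u = x + h / 2) -> (v = y \/ v = y + k / 2) ->
  Rabs (circulation P Q u v (h / 2) (k / 2)) <= eps * (h / 2 + k / 2) ^ 2).
{ intros u v Hu Hv. apply Rnot_lt_le. intros L. apply N. now exists (u, v). }
rewrite circulation_split in Big by assumption.
assert (S1 := Small x y ltac:(tauto) ltac:(tauto)).
assert (S2 := Small (x + h / 2) y ltac:(tauto) ltac:(tauto)).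
assert (S3 := Small x (y + k / 2) ltac:(tauto) ltac:(tauto)).
assert (S4 := Small (x + h / 2) (y + k / 2) ltac:(tauto) ltac:(tauto)).
replace (eps * (h + k) ^ 2) with (4 * (eps * (h / 2 + k / 2) ^ 2)) in Big by field.
revert Big. apply Rle_not_lt.
apply Rabs_le_between in S1. apply Rabs_le_between in S2.
apply Rabs_le_between in S3. apply Rabs_le_between in S4.
apply Rabs_le. lra.
Qed.

End Goursat.

(** The intervals are nested, so every left endpoint lies below every right endpoint, and the
    supremum of the left endpoints belongs to all of them. *)
Lemma nested_halving (x : nat -> R) (h : R) : 0 <= h ->
  (forall n, x (S n) = x n \/ x (S n) = x n + h / 2 ^ S n) ->
  exists u, forall n, x n <= u <= x n + h / 2 ^ n.
Proof.
intros Hh Hx.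
assert (Hp : forall n, h / 2 ^ n = 2 * (h / 2 ^ S n)).
{ intros n. simpl. field. apply pow_nonzero; lra. }
assert (H0 : forall n, 0 <= h / 2 ^ n).
{ intros n. apply Rmult_le_pos; [lra | ]. left. apply Rinv_0_lt_compat, pow_lt; lra. }
assert (inc : forall n m, x n <= x (n + m)%nat /\
  x (n + m)%nat + h / 2 ^ (n + m) <= x n + h / 2 ^ n).
{ intros n. induction m as [ | m IH].
  - rewrite Nat.add_0_r. lra.
  - rewrite Nat.add_succ_r. specialize (Hp (n + m)%nat). specialize (H0 (S (n + m))).
    destruct (Hx (n + m)%nat) as [E | E]; rewrite E; lra. }
assert (le : forall n m, x m <= x n + h / 2 ^ n).
{ intros n m. destruct (inc n m) as [_ A]. destruct (inc m n) as [B _].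
  rewrite (Nat.add_comm m n) in B. specialize (H0 (n + m)%nat). lra. }
destruct (completeness (fun r => exists n, r = x n)) as [u [U1 U2]].
- exists (x 0%nat + h / 2 ^ 0). intros r [n ->]. apply le.
- exists (x 0%nat). now exists 0%nat.
- exists u. intros n. split; [apply U1; now exists n | ].
  apply U2. intros r [m ->]. apply le.
Qed.

Theorem goursat (P Q : R -> R -> R) (x0 y0 h0 k0 : R) : 0 <= h0 -> 0 <= k0 ->
  (forall x y, x0 <= x <= x0 + h0 -> y0 <= y <= y0 + k0 -> closed_form_at P Q x y) ->
  circulation P Q x0 y0 h0 k0 = 0.
Proof.
intros Hh Hk Hcl. apply NNPP. intros N. apply Rabs_pos_lt in N.
(* Makes [eps * (h0 + k0) ^ 2] less than half of the circulation; the [+ 1] keeps the denominator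
   positive for a degenerate rectangle. *)
set (eps := Rabs (circulation P Q x0 y0 h0 k0) / (2 * ((h0 + k0) ^ 2 + 1))).
assert (Hs : 0 <= (h0 + k0) ^ 2) by apply pow2_ge_0.
assert (Heps : 0 < eps) by (apply Rdiv_lt_0_compat; lra).
assert (Big0 : eps * (h0 + k0) ^ 2 < Rabs (circulation P Q x0 y0 h0 k0)).
{ replace (Rabs (circulation P Q x0 y0 h0 k0)) with (eps * (2 * ((h0 + k0) ^ 2 + 1)))
    by (unfold eps; field; lra).
  apply Rmult_lt_compat_l; lra. }
(* Picks the corner of a quarter that still violates the bound. The value is arbitrary if there is
   none, which [bisection_step] excludes along the sequence [p]. *)
set (choice := fun (x y h k : R) => epsilon (inhabits (0, 0)) (fun p : R * R =>
  (fst p = x \/ fst p = x + h / 2) /\ (snd p = y \/ snd p = y + k / 2) /\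
  eps * (h / 2 + k / 2) ^ 2 < Rabs (circulation P Q (fst p) (snd p) (h / 2) (k / 2)))).
set (p := fix p (n : nat) : R * R := match n with
  | O => (x0, y0)
  | S m => choice (fst (p m)) (snd (p m)) (h0 / 2 ^ m) (k0 / 2 ^ m) end).
assert (half : forall t n, t / 2 ^ n / 2 = t / 2 ^ S n).
{ intros t n. simpl. field. apply pow_nonzero; lra. }
assert (pos : forall t n, 0 <= t -> 0 <= t / 2 ^ n).
{ intros t n Ht. apply Rmult_le_pos; [lra | ]. left. apply Rinv_0_lt_compat, pow_lt; lra. }
set (inside := fun n => x0 <= fst (p n) /\ fst (p n) + h0 / 2 ^ n <= x0 + h0 /\
  y0 <= snd (p n) /\ snd (p n) + k0 / 2 ^ n <= y0 + k0 /\
  eps * (h0 / 2 ^ n + k0 / 2 ^ n) ^ 2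
    < Rabs (circulation P Q (fst (p n)) (snd (p n)) (h0 / 2 ^ n) (k0 / 2 ^ n))).
assert (step : forall n, inside n ->
  (fst (p (S n)) = fst (p n) \/ fst (p (S n)) = fst (p n) + h0 / 2 ^ S n) /\
  (snd (p (S n)) = snd (p n) \/ snd (p (S n)) = snd (p n) + k0 / 2 ^ S n) /\
  eps * (h0 / 2 ^ S n + k0 / 2 ^ S n) ^ 2
  < Rabs (circulation P Q (fst (p (S n))) (snd (p (S n))) (h0 / 2 ^ S n) (k0 / 2 ^ S n))).
{ intros n (I1 & I2 & I3 & I4 & I5).
  assert (St := bisection_step P Q x0 y0 h0 k0 Hcl eps _ _ _ _
    (pos h0 n Hh) (pos k0 n Hk) I1 I2 I3 I4 I5).
  apply (epsilon_spec (inhabits (0, 0))) in St. rewrite !half in St.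
  change (p (S n)) with (choice (fst (p n)) (snd (p n)) (h0 / 2 ^ n) (k0 / 2 ^ n)).
  unfold choice. rewrite !half. exact St. }
assert (inv : forall n, inside n).
{ induction n as [ | n IH].
  - assert (E : forall t, t / 2 ^ 0 = t) by (intros; simpl; field).
    unfold inside. rewrite !E. simpl fst. simpl snd. repeat split; lra.
  - destruct (step n IH) as (I6 & I7 & I8). destruct IH as (I1 & I2 & I3 & I4 & I5).
    assert (A1 := half h0 n). assert (A2 := half k0 n).
    assert (A3 := pos h0 n Hh). assert (A4 := pos k0 n Hk).
    unfold inside. repeat split; try exact I8;
      destruct I6; destruct I7; lra. }
destruct (nested_halving (fun n => fst (p n)) h0 Hh) as [u Hu]; [intros n; apply step, inv | ].
destruct (nested_halving (fun n => snd (p n)) k0 Hk) as [v Hv]; [intros n; apply step, inv | ].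
assert (Bu := Hu 0%nat). assert (Bv := Hv 0%nat). simpl in Bu, Bv.
destruct (circulation_local P Q x0 y0 h0 k0 Hcl eps u v Heps) as [d [Hd Loc]]; [lra | lra | ].
assert (Hlim : exists n, (h0 + k0) / 2 ^ n < d).
{ destruct (pow_lt_1_zero (/ 2) ltac:(rewrite Rabs_pos_eq; lra) (d / (h0 + k0 + 1)))
    as [n Hn]; [apply Rdiv_lt_0_compat; lra | ].
  exists n. specialize (Hn n (Nat.le_refl n)).
  rewrite Rabs_pos_eq, pow_inv in Hn by (apply pow_le; lra).
  assert (A : 0 < / 2 ^ n) by (apply Rinv_0_lt_compat, pow_lt; lra).
  apply (Rmult_lt_compat_r (h0 + k0 + 1)) in Hn; [ | lra].
  replace (d / (h0 + k0 + 1) * (h0 + k0 + 1)) with d in Hn by (field; lra).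
  unfold Rdiv. nra. }
(* The [n]-th rectangle contains [(u, v)] and has sides shorter than [d], so [Loc] contradicts the
   lower bound recorded in [inside n]. *)
destruct Hlim as [n Hn]. destruct (inv n) as (I1 & I2 & I3 & I4 & I5).
revert I5. apply Rle_not_lt.
assert (A1 := pos h0 n Hh). assert (A2 := pos k0 n Hk).
replace ((h0 + k0) / 2 ^ n) with (h0 / 2 ^ n + k0 / 2 ^ n) in Hn
  by (field; apply pow_nonzero; lra).
apply Loc; try lra; [apply Hu | apply Hv].
Qed.

(** * The mean value property *)

Lemma Rabs_fst_le_Cmod (z : C) : Rabs (fst z) <= Cmod z.
Proof. eapply Rle_trans; [ | apply Rmax_Cmod]. apply Rmax_l. Qed.

Lemma Rabs_snd_le_Cmod (z : C) : Rabs (snd z) <= Cmod z.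
Proof. eapply Rle_trans; [ | apply Rmax_Cmod]. apply Rmax_r. Qed.

Lemma Cmod_le_2Rmax (z : C) : Cmod z <= 2 * Rmax (Rabs (fst z)) (Rabs (snd z)).
Proof.
eapply Rle_trans; [apply Cmod_2Rmax | ]. apply Rmult_le_compat_r.
- eapply Rle_trans; [apply Rabs_pos | apply Rmax_l].
- replace 2 with (sqrt (2 * 2)) at 2 by (apply sqrt_square; lra).
  apply sqrt_le_1; lra.
Qed.

(** The complex remainder dominates the remainder of each component. The halves [eps / 2] and
    [d / 2] absorb the factor 2 between the modulus and the maximum norm of
    [differentiable_pt_lim]. *)
Lemma has_cderiv_cauchy_riemann (g : C -> C) (x y a b : R) :
  has_cderiv g (x, y) (a, b) ->
  differentiable_pt_lim (fun u v => fst (g (u, v))) x y a (- b) /\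
  differentiable_pt_lim (fun u v => snd (g (u, v))) x y b a.
Proof.
intros H.
assert (main : forall eps : posreal, locally_2d (fun u v =>
  Cmod (Csub (Csub (g (u, v)) (g (x, y))) (Cmul (a, b) (u - x, v - y)))
    <= eps * Rmax (Rabs (u - x)) (Rabs (v - y))) x y).
{ intros eps. assert (He : 0 < eps / 2) by (destruct eps; simpl; lra).
  destruct (H _ He) as [d [Hd Hdd]].
  assert (Hd2 : 0 < d / 2) by lra. exists (mkposreal _ Hd2). simpl. intros u v Hu Hv.
  assert (M := Cmod_le_2Rmax (u - x, v - y)). simpl in M.
  (* [has_cderiv] only speaks of nonzero increments, so the zero increment is treated apart. *)
  destruct (Rle_lt_or_eq_dec 0 (Cmod (u - x, v - y)) (Cmod_ge_0 _)) as [Pos | Zero].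
  - specialize (Hdd (u - x, v - y)).
    replace (Cadd (x, y) (u - x, v - y)) with (u, v) in Hdd
      by (unfold Cadd; simpl; f_equal; ring).
    assert (Rmax (Rabs (u - x)) (Rabs (v - y)) < d / 2) by (apply Rmax_lub_lt; assumption).
    eapply Rle_trans; [apply Hdd | ].
    + split; [exact Pos | ]. eapply Rle_lt_trans; [exact M | lra].
    + change (Defs.Cmod (u - x, v - y)) with (Cmod (u - x, v - y)).
      apply (Rmult_le_compat_l (eps / 2)) in M; lra.
  - symmetry in Zero. apply Cmod_eq_0 in Zero. injection Zero as E1 E2.
    rewrite E1, E2. replace u with x by lra. replace v with y by lra.
    match goal with |- Cmod ?t <= _ => replace t with (RtoC 0) end.
    + rewrite Cmod_0, Rabs_R0. rewrite Rmax_left by lra. lra.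
    + apply injective_projections; simpl; ring. }
split; intros eps; destruct (main eps) as [d Hd]; exists d; intros u v Hu Hv;
  (eapply Rle_trans; [ | exact (Hd u v Hu Hv)]).
- eapply Rle_trans; [ | apply Rabs_fst_le_Cmod]. apply Req_le. f_equal. simpl. ring.
- eapply Rle_trans; [ | apply Rabs_snd_le_Cmod]. apply Req_le. f_equal. simpl. ring.
Qed.

Lemma differentiable_pt_lim_Rmult (x y : R) : differentiable_pt_lim Rmult x y y x.
Proof.
intros eps. exists eps. intros u v Hu Hv.
replace (u * v - x * y - (y * (u - x) + x * (v - y))) with ((u - x) * (v - y)) by ring.
rewrite Rabs_mult. apply Rmult_le_compat; try apply Rabs_pos; [lra | apply Rmax_r].
Qed.

Lemma differentiable_pt_lim_proj2 (f : R -> R) (x y l : R) :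
  is_derive f y l -> differentiable_pt_lim (fun _ v => f v) x y 0 l.
Proof.
intros H. apply is_derive_Reals in H.
assert (Id : differentiable_pt_lim (fun _ v : R => v) x y 0 1).
{ intros eps. exists eps. intros u v _ _.
  replace (v - y - (0 * (u - x) + 1 * (v - y))) with 0 by ring. rewrite Rabs_R0.
  apply Rmult_le_pos; [left; apply eps | ].
  eapply Rle_trans; [apply Rabs_pos | apply Rmax_l]. }
assert (D := differentiable_pt_lim_comp (fun u _ => f u) (fun _ v => v) (fun _ v => v)
  x y _ _ _ _ _ _ (differentiable_pt_lim_proj1_0 f y y l H) Id Id).
simpl in D. replace 0 with (l * 0 + 0 * 0) by ring. replace l with (l * 1 + 0 * 1) at 2 by ring.
exact D.
Qed.

Lemma differentiable_pt_lim_separate (f g : R -> R) (x y a b : R) :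
  is_derive f x a -> is_derive g y b ->
  differentiable_pt_lim (fun u v => f u * g v) x y (a * g y) (f x * b).
Proof.
intros Hf Hg. apply is_derive_Reals in Hf.
assert (D := differentiable_pt_lim_comp Rmult (fun u _ => f u) (fun _ v => g v)
  x y _ _ _ _ _ _ (differentiable_pt_lim_Rmult _ _) (differentiable_pt_lim_proj1_0 f x y a Hf)
  (differentiable_pt_lim_proj2 g x y b Hg)).
replace (a * g y) with (g y * a + f x * 0) by ring.
replace (f x * b) with (g y * 0 + f x * b) by ring. exact D.
Qed.

Lemma Cmod_polar (r t : R) : 0 <= r -> Cmod (r * cos t, r * sin t) = r.
Proof.
intros Hr. unfold Cmod. simpl fst. simpl snd. apply sqrt_lem_1; try lra.
- assert (0 <= (r * cos t) ^ 2) by apply pow2_ge_0.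
  assert (0 <= (r * sin t) ^ 2) by apply pow2_ge_0. lra.
- assert (E := sin2_cos2 t). unfold Rsqr in E.
  replace ((r * cos t) ^ 2 + (r * sin t) ^ 2)
    with (r * r * (sin t * sin t + cos t * cos t)) by ring.
  rewrite E. ring.
Qed.

(* In the coordinates [z = exp (s + i t)] the form [Im (g dz / z)] is
   [Im g ds + Re g dt], which is closed by the Cauchy-Riemann equations. *)
Lemma closed_form_log_polar (g : C -> C) (s t : R) :
  (exists l, has_cderiv g (exp s * cos t, exp s * sin t) l) ->
  closed_form_at (fun s t => snd (g (exp s * cos t, exp s * sin t)))
    (fun s t => fst (g (exp s * cos t, exp s * sin t))) s t.
Proof.
intros [[a b] H]. apply has_cderiv_cauchy_riemann in H. destruct H as [H1 H2].
assert (De : is_derive exp s (exp s)) by apply is_derive_exp.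
assert (Dc : is_derive cos t (- sin t)) by apply is_derive_cos.
assert (Ds : is_derive sin t (cos t)) by apply is_derive_sin.
assert (C1 := differentiable_pt_lim_separate exp cos s t _ _ De Dc).
assert (C2 := differentiable_pt_lim_separate exp sin s t _ _ De Ds).
assert (D1 := differentiable_pt_lim_comp (fun u v => fst (g (u, v)))
  (fun s t => exp s * cos t) (fun s t => exp s * sin t) s t _ _ _ _ _ _ H1 C1 C2).
assert (D2 := differentiable_pt_lim_comp (fun u v => snd (g (u, v)))
  (fun s t => exp s * cos t) (fun s t => exp s * sin t) s t _ _ _ _ _ _ H2 C1 C2).
simpl in D1, D2. do 3 eexists. split; [exact D2 | ].
replace (b * (exp s * - sin t) + a * (exp s * cos t))
  with (a * (exp s * cos t) + - b * (exp s * sin t)) by ring.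
exact D1.
Qed.

Lemma continuous_circle (g : C -> C) (r t : R) : 0 < r ->
  (exists l, has_cderiv g (r * cos t, r * sin t) l) ->
  continuous (fun t => fst (g (r * cos t, r * sin t))) t.
Proof.
intros Hr H. rewrite <- (exp_ln r Hr) in H |- *.
destruct (closed_form_log_polar g (ln r) t H) as (a & b & c & _ & D).
apply differentiable_pt_lim_continuity, continuity_2d_pt_row in D. exact D.
Qed.

Lemma ex_RInt_circle (g : C -> C) (r a b : R) :
  (forall z, 0 < Cmod z < 1 -> exists l, has_cderiv g z l) -> 0 < r < 1 ->
  ex_RInt (fun t => fst (g (r * cos t, r * sin t))) a b.
Proof.
intros H Hr. apply (ex_RInt_continuous (V := R_CompleteNormedModule)).
intros t _. apply continuous_circle; [lra | ]. apply H. rewrite Cmod_polar; lra.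
Qed.

(** In log-polar coordinates the annulus becomes the rectangle [[ln r1, ln r2] x [0, 2 PI]]. Its
    sides [t = 0] and [t = 2 PI] cancel by periodicity, and Goursat equates the other two, which are
    the circle integrals. *)
Lemma circle_mean_constant (g : C -> C) (r1 r2 : R) :
  (forall z, 0 < Cmod z < 1 -> exists l, has_cderiv g z l) -> 0 < r1 <= r2 -> r2 < 1 ->
  RInt (fun t => fst (g (r1 * cos t, r1 * sin t))) 0 (2 * PI) =
  RInt (fun t => fst (g (r2 * cos t, r2 * sin t))) 0 (2 * PI).
Proof.
intros H H12 H2. assert (PIpos := PI_RGT_0).
assert (E := goursat (fun s t => snd (g (exp s * cos t, exp s * sin t)))
  (fun s t => fst (g (exp s * cos t, exp s * sin t)))
  (ln r1) 0 (ln r2 - ln r1) (2 * PI)).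
assert (L : ln r1 <= ln r2) by (apply ln_le; lra).
unfold circulation in E. rewrite Rplus_0_l in E.
replace (ln r1 + (ln r2 - ln r1)) with (ln r2) in E by ring.
rewrite cos_2PI, sin_2PI, cos_0, sin_0, !exp_ln in E by lra.
rewrite Rminus_diag, Rplus_0_l in E. symmetry.
apply Rminus_diag_uniq, E; [lra | lra | ].
intros s t Hs _. apply closed_form_log_polar, H.
rewrite Cmod_polar by (left; apply exp_pos). split; [apply exp_pos | ].
eapply Rle_lt_trans; [ | exact H2]. rewrite <- (exp_ln r2) by lra.
destruct (proj2 Hs) as [A | A]; [left; now apply exp_increasing | rewrite A; lra].
Qed.

(** The circle can be shrunk towards 0 without changing the integral, and there [Re g] is uniformly
    close to [m]. Only the punctured disc is involved, so that [g] can be a quotient [f z / z]. *)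
Theorem mean_value (g : C -> C) (m r : R) :
  (forall z, 0 < Cmod z < 1 -> exists l, has_cderiv g z l) ->
  (forall eps, 0 < eps -> exists delta, 0 < delta /\
     forall z, 0 < Cmod z < delta -> Rabs (fst (g z) - m) <= eps) ->
  0 < r < 1 ->
  RInt (fun t => fst (g (r * cos t, r * sin t))) 0 (2 * PI) = 2 * PI * m.
Proof.
intros H Lim Hr. assert (PIpos := PI_RGT_0).
apply Rminus_diag_uniq, NNPP. intros N. apply Rabs_pos_lt in N.
set (J := RInt (fun t => fst (g (r * cos t, r * sin t))) 0 (2 * PI)) in *.
(* Integrated over length [2 * PI], this tolerance bounds the discrepancy by half of itself. *)
destruct (Lim (Rabs (J - 2 * PI * m) / (4 * PI))) as (d & Hd & Hdd).
{ apply Rdiv_lt_0_compat; lra. }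
set (r1 := Rmin r (d / 2)).
assert (0 < r1) by (apply Rmin_pos; lra).
assert (R1 : r1 <= r) by apply Rmin_l. assert (R2 : r1 <= d / 2) by apply Rmin_r.
assert (B : Rabs (J - 2 * PI * m) <= 2 * PI * (Rabs (J - 2 * PI * m) / (4 * PI))).
{ unfold J at 1. rewrite <- (circle_mean_constant g r1 r) by (assumption || lra).
  assert (X := RInt_sub_const_bound (fun t => fst (g (r1 * cos t, r1 * sin t))) (fun _ => 0)
    0 (2 * PI) m (Rabs (J - 2 * PI * m) / (4 * PI))).
  rewrite Rplus_0_l, RInt_const in X. unfold scal in X; simpl in X. unfold mult in X; simpl in X.
  rewrite Rmult_0_r, Rminus_0_r in X. apply X; [lra | | | ].
  - apply ex_RInt_circle; [exact H | lra].
  - apply ex_RInt_const.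
  - intros s _. rewrite Rminus_0_r. apply Hdd. rewrite Cmod_polar; lra. }
replace (2 * PI * (Rabs (J - 2 * PI * m) / (4 * PI))) with (Rabs (J - 2 * PI * m) / 2) in B
  by (field; lra).
lra.
Qed.

(** * Complex derivatives and the Schwarz-Pick inequality *)

Lemma RtoC_nonzero (x : R) : x <> 0 -> RtoC x <> 0.
Proof. intros H E. apply H. now apply RtoC_inj. Qed.

(** Transfers the differentiation rules for [is_derive] over [C_AbsRing] to [has_cderiv]. The two
    notions differ in the order of the product and in the zero increment. *)
Lemma has_cderiv_is_derive (f : C -> C) (z l : C) :
  has_cderiv f z l <->
  is_derive (K := C_AbsRing) (V := AbsRing_NormedModule C_AbsRing) f z l.
Proof.
split.
- intros H. split; [apply is_linear_scal_l | ].
  intros x Hx.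
  apply (is_filter_lim_locally_unique (V := AbsRing_NormedModule C_AbsRing)) in Hx. subst x.
  intros eps. destruct (H eps (cond_pos eps)) as [d [Hd Hdd]].
  exists (mkposreal d Hd). refine (fun (y : C) Hy => _). change (Cmod (y - z) < d) in Hy.
  change (Cmod (f y - f z - (y - z) * l) <= eps * Cmod (y - z)).
  destruct (Rle_lt_or_eq_dec 0 _ (Cmod_ge_0 (y - z))) as [Pos | Zero].
  + specialize (Hdd (y - z)%C (conj Pos Hy)).
    change (Cmod (f (z + (y - z)) - f z - l * (y - z))%C <= eps * Cmod (y - z)) in Hdd.
    replace (z + (y - z))%C with y in Hdd by ring.
    now rewrite (Cmult_comm (y - z) l).
  + symmetry in Zero. rewrite Zero. apply Cmod_eq_0 in Zero.
    replace y with z by (rewrite <- (Cplus_0_r z), <- Zero; ring).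
    replace (f z - f z - (z - z) * l)%C with (RtoC 0) by ring. rewrite Cmod_0. lra.
- intros [_ H] eps Heps.
  destruct (H z (fun P HP => HP) (mkposreal eps Heps)) as [d Hd].
  exists d. split; [apply d | ]. refine (fun (h : C) Hh => _). specialize (Hd (z + h)%C).
  change (Cmod (z + h - z) < d ->
    Cmod (f (z + h) - f z - (z + h - z) * l)%C <= eps * Cmod (z + h - z)) in Hd.
  change (Cmod (f (z + h) - f z - l * h)%C <= eps * Cmod h).
  replace (z + h - z)%C with h in Hd by ring. rewrite (Cmult_comm l h). apply Hd, Hh.
Qed.

Lemma has_cderiv_const (k z : C) : has_cderiv (fun _ => k) z (RtoC 0).
Proof.
apply has_cderiv_is_derive.
exact (is_derive_const (K := C_AbsRing) (V := AbsRing_NormedModule C_AbsRing) k z).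
Qed.

Lemma has_cderiv_id (z : C) : has_cderiv (fun x => x) z (RtoC 1).
Proof. apply has_cderiv_is_derive. exact (is_derive_id (K := C_AbsRing) z). Qed.

Lemma has_cderiv_plus (f g : C -> C) (z a b : C) :
  has_cderiv f z a -> has_cderiv g z b -> has_cderiv (fun x => f x + g x)%C z (a + b)%C.
Proof.
rewrite !has_cderiv_is_derive.
exact (is_derive_plus (K := C_AbsRing) (V := AbsRing_NormedModule C_AbsRing) f g z a b).
Qed.

Lemma has_cderiv_mult (f g : C -> C) (z a b : C) :
  has_cderiv f z a -> has_cderiv g z b ->
  has_cderiv (fun x => f x * g x)%C z (a * g z + f z * b)%C.
Proof.
rewrite !has_cderiv_is_derive. intros Hf Hg.
exact (is_derive_mult (K := C_AbsRing) f g z a b Hf Hg Cmult_comm).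
Qed.

Lemma has_cderiv_scal (k : C) (f : C -> C) (z l : C) :
  has_cderiv f z l -> has_cderiv (fun x => k * f x)%C z (k * l)%C.
Proof.
intros H. assert (D := has_cderiv_mult _ _ _ _ _ (has_cderiv_const k z) H).
cbv beta in D. now rewrite Cmult_0_l, Cplus_0_l in D.
Qed.

Lemma has_cderiv_comp (f g : C -> C) (z a b : C) :
  has_cderiv f (g z) a -> has_cderiv g z b -> has_cderiv (fun x => f (g x)) z (a * b)%C.
Proof.
rewrite !has_cderiv_is_derive, (Cmult_comm a b).
exact (is_derive_comp (K := C_AbsRing) (V := AbsRing_NormedModule C_AbsRing) f g z a b).
Qed.

(** The error of the linear approximation is exactly [h^2 / (z^2 (z + h))]. For [|h| < |z| / 2] its
    denominator has modulus at least [|z|^3 / 2], which explains both bounds under [Rmin]. *)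
Lemma has_cderiv_inv (z : C) : z <> 0 -> has_cderiv (fun x => / x)%C z (- (/ (z * z)))%C.
Proof.
intros Hz eps Heps. assert (Pz : 0 < Cmod z) by now apply Cmod_gt_0.
set (K := Cmod z ^ 3).
assert (PK : 0 < K) by (apply pow_lt; exact Pz).
exists (Rmin (Cmod z / 2) (eps * K / 2)). split.
{ apply Rmin_pos; [lra | ]. assert (0 < eps * K) by now apply Rmult_lt_0_compat. lra. }
refine (fun (h : C) Hh0 => _). destruct Hh0 as [Hh Hd]. change (Defs.Cmod h) with (Cmod h) in *.
assert (M1 := Rmin_l (Cmod z / 2) (eps * K / 2)).
assert (M2 := Rmin_r (Cmod z / 2) (eps * K / 2)).
assert (T : Cmod z / 2 <= Cmod (z + h)).
{ assert (X := Cmod_triangle (z + h) (- h)). rewrite Cmod_opp in X.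
  replace (z + h + - h)%C with z in X by ring. lra. }
assert (Hzh : (z + h)%C <> 0) by (apply Cmod_gt_0; lra).
change (Cmod (/ (z + h) - / z - - / (z * z) * h) <= eps * Cmod h).
replace (/ (z + h) - / z - - / (z * z) * h)%C with (h * h / (z * z * (z + h)))%C
  by (field; repeat split; assumption).
rewrite Cmod_div by (repeat apply Cmult_neq_0; assumption).
rewrite !Cmod_mult.
apply Rmult_le_reg_r with (Cmod z * Cmod z * Cmod (z + h)).
{ repeat apply Rmult_lt_0_compat; lra. }
unfold Rdiv. rewrite Rmult_assoc, Rinv_l by (apply Rgt_not_eq; repeat apply Rmult_lt_0_compat; lra).
rewrite Rmult_1_r.
assert (X : eps * (K / 2) <= eps * (Cmod z * Cmod z * Cmod (z + h))).
{ apply Rmult_le_compat_l; [lra | ]. unfold K.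
  replace (Cmod z ^ 3 / 2) with (Cmod z * Cmod z * (Cmod z / 2)) by field.
  apply Rmult_le_compat_l; [ | exact T]. apply Rmult_le_pos; lra. }
replace (eps * Cmod h * (Cmod z * Cmod z * Cmod (z + h)))
  with (Cmod h * (eps * (Cmod z * Cmod z * Cmod (z + h)))) by ring.
apply Rmult_le_compat_l; lra.
Qed.

Lemma has_cderiv_div (f g : C -> C) (z a b : C) :
  has_cderiv f z a -> has_cderiv g z b -> g z <> 0 ->
  has_cderiv (fun x => f x / g x)%C z ((a * g z - f z * b) / (g z * g z))%C.
Proof.
intros Hf Hg Nz.
assert (D := has_cderiv_mult _ _ _ _ _ Hf (has_cderiv_comp _ _ _ _ _ (has_cderiv_inv _ Nz) Hg)).
replace ((a * g z - f z * b) / (g z * g z))%C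
  with (a * / g z + f z * (- / (g z * g z) * b))%C by (field; exact Nz).
exact D.
Qed.

Lemma has_cderiv_unique (f : C -> C) (z a b : C) :
  has_cderiv f z a -> has_cderiv f z b -> a = b.
Proof.
destruct z as [x y], a as [a1 a2], b as [b1 b2].
intros Ha Hb. apply has_cderiv_cauchy_riemann in Ha. apply has_cderiv_cauchy_riemann in Hb.
destruct Ha as [Ha1 Ha2], Hb as [Hb1 Hb2].
apply differentiable_pt_lim_unique in Ha1, Ha2, Hb1, Hb2. f_equal.
- transitivity (Derive (fun t => fst (f (t, y))) x); [symmetry | ]; tauto.
- transitivity (Derive (fun t => snd (f (t, y))) x); [symmetry | ]; tauto.
Qed.

Lemma has_cderiv_ext_disc (f g : C -> C) (z l : C) :
  (forall x, Cmod x < 1 -> f x = g x) -> Cmod z < 1 -> has_cderiv f z l -> has_cderiv g z l.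
Proof.
intros E Hz H eps Heps. destruct (H eps Heps) as [d [Hd Hdd]].
exists (Rmin d (1 - Cmod z)). split; [apply Rmin_pos; lra | ].
refine (fun (h : C) Hh1 => _). destruct Hh1 as [Hh0 Hh].
assert (M1 := Rmin_l d (1 - Cmod z)). assert (M2 := Rmin_r d (1 - Cmod z)).
change (Defs.Cmod h) with (Cmod h) in *.
rewrite <- (E z Hz), <- (E (Cadd z h)).
- apply Hdd. split; [exact Hh0 | change (Cmod h < d); lra].
- change (Cmod (z + h) < 1). assert (X := Cmod_triangle z h). lra.
Qed.

Lemma has_cderiv_along_ray (f : C -> C) (v l : C) (s : R) :
  has_cderiv f (s * v)%C l -> is_derive (fun t : R => fst (f (t * v)%C)) s (fst (l * v)%C).
Proof.
destruct l as [a b], v as [v1 v2]. intros H.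
assert (E : forall t : R, (t * (v1, v2))%C = (t * v1, t * v2)).
{ intros t. apply injective_projections; simpl; ring. }
rewrite E in H. apply has_cderiv_cauchy_riemann in H. destruct H as [H _].
assert (L : forall k, derivable_pt_lim (fun t => t * k) s k).
{ intros k. apply is_derive_Reals. auto_derive; [exact I | ring]. }
assert (D := derivable_pt_lim_comp_2d _ (fun t => t * v1) (fun t => t * v2) s _ _ _ _ H
  (L v1) (L v2)).
apply is_derive_Reals in D. simpl fst.
replace (a * v1 - b * v2) with (a * v1 + - b * v2) by ring.
eapply is_derive_ext; [ | exact D]. intros t. simpl. now rewrite E.
Qed.

(** * Self-maps of the disc and the Schwarz bound for the derivative at 0 *)

Definition self_map_of_disc (f : C -> C) : Prop :=
  forall z, Cmod z < 1 -> Cmod (f z) < 1 /\ exists l, has_cderiv f z l.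

Lemma self_map_comp (f g : C -> C) :
  self_map_of_disc f -> self_map_of_disc g -> self_map_of_disc (fun z => f (g z)).
Proof.
intros Hf Hg z Hz. destruct (Hg z Hz) as [Gz [b Db]]. destruct (Hf _ Gz) as [Fz [a Da]].
split; [exact Fz | ]. exists (a * b)%C. now apply has_cderiv_comp.
Qed.

Lemma self_map_rotate (f : C -> C) (u : C) :
  Cmod u = 1 -> self_map_of_disc f -> self_map_of_disc (fun z => u * f z)%C.
Proof.
intros Hu Hf z Hz. destruct (Hf z Hz) as [Fz [l Dl]]. split.
- now rewrite Cmod_mult, Hu, Rmult_1_l.
- exists (u * l)%C. now apply has_cderiv_scal.
Qed.

(** The rotation by [u] turns a modulus into a real part, the quantity that the mean value and
    [artanh] estimates control. *)
Lemma exists_conj_phase (z : C) : exists u, Cmod u = 1 /\ (u * z)%C = Cmod z.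
Proof.
destruct (classic (z = 0)) as [-> | Nz].
- exists 1. rewrite Cmod_1, Cmod_0. split; [reflexivity | ring].
- assert (P : 0 < Cmod z) by now apply Cmod_gt_0.
  assert (N : RtoC (Cmod z) <> 0) by (intros E; apply RtoC_inj in E; lra).
  exists (Cconj z / Cmod z)%C. split.
  + rewrite Cmod_div, Cmod_conj, Cmod_R, Rabs_pos_eq by (assumption || lra). field. lra.
  + replace (Cconj z / Cmod z * z)%C with (z * Cconj z / Cmod z)%C by (field; exact N).
    rewrite <- Cmod2_conj. rewrite RtoC_pow. simpl. field. exact N.
Qed.

(** Since [f 0 = 0], the quotient [f z / z] tends to the derivative [l] at 0, so [mean_value]
    applies with [m = Re l]. *)
Lemma mean_value_quotient (f : C -> C) (l : C) (r : R) :
  (forall z, Cmod z < 1 -> exists l, has_cderiv f z l) -> f 0 = 0 -> has_cderiv f (RtoC 0) l ->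
  0 < r < 1 ->
  RInt (fun t => fst (Cdiv (f (r * cos t, r * sin t)) ((r * cos t)%R, (r * sin t)%R))) 0 (2 * PI)
  = 2 * PI * fst l.
Proof.
intros Hf F0 D0 Hr. apply (mean_value (fun z => f z / z)%C); [ | | exact Hr].
- intros z Hz. destruct (Hf z (proj2 Hz)) as [a Da]. eexists.
  apply has_cderiv_div; [exact Da | apply has_cderiv_id | now apply Cmod_gt_0].
- intros eps Heps. destruct (D0 eps Heps) as [d [Hd Hdd]]. exists d. split; [exact Hd | ].
  refine (fun (z : C) Hz => _). specialize (Hdd z Hz).
  change (Cmod (f (0 + z) - f 0 - l * z)%C <= eps * Cmod z) in Hdd.
  rewrite Cplus_0_l, F0 in Hdd.
  assert (Nz : z <> 0) by now apply Cmod_gt_0.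
  eapply Rle_trans; [exact (Rabs_fst_le_Cmod (f z / z - l)) | ].
  apply Rmult_le_reg_r with (Cmod z); [tauto | ]. rewrite <- Cmod_mult.
  replace ((f z / z - l) * z)%C with (f z - 0 - l * z)%C by (field; exact Nz). exact Hdd.
Qed.

(** After a rotation the mean of [Re (f z / z)] over a circle of radius [r] is [|l|], while
    [|f z / z| < 1 / r] there. If [|l| > 1], the radius [r = 2 / (1 + |l|)] lies below 1 and gives
    [1 / r = (1 + |l|) / 2 < |l|]. *)
Lemma schwarz_deriv (f : C -> C) (l : C) :
  self_map_of_disc f -> f 0 = 0 -> has_cderiv f (RtoC 0) l -> Cmod l <= 1.
Proof.
intros Hf F0 D0. apply Rnot_lt_le. intros L.
destruct (exists_conj_phase l) as (u & Hu & Ul).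
assert (PIpos := PI_RGT_0).
assert (Hr : 0 < 2 / (1 + Cmod l) < 1).
{ split; [apply Rdiv_lt_0_compat; lra | ].
  apply (Rmult_lt_reg_r (1 + Cmod l)); [lra | ]. unfold Rdiv. rewrite Rmult_assoc, Rinv_l; lra. }
assert (Hf' := self_map_rotate f u Hu Hf).
assert (G0 : (u * f 0)%C = 0) by (rewrite F0; ring).
assert (GD : has_cderiv (fun z => u * f z)%C (RtoC 0) (u * l)%C)
  by (apply has_cderiv_scal; exact D0).
assert (M := mean_value_quotient (fun z => u * f z)%C (u * l) _
  (fun z Hz => proj2 (Hf' z Hz)) G0 GD Hr).
rewrite Ul in M. simpl fst in M at 2.
assert (DQ : forall z, 0 < Cmod z < 1 -> exists a, has_cderiv (fun z => u * f z / z)%C z a).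
{ intros z Hz. destruct (Hf' z (proj2 Hz)) as [_ [a Da]]. eexists.
  apply (has_cderiv_div (fun z => u * f z)%C);
    [exact Da | apply has_cderiv_id | now apply Cmod_gt_0]. }
assert (B := abs_RInt_le_const _ 0 (2 * PI) ((1 + Cmod l) / 2) ltac:(lra)
  (ex_RInt_circle _ _ 0 (2 * PI) DQ Hr)).
simpl in M, B. rewrite M in B. clear M.
rewrite Rabs_pos_eq, Rminus_0_r in B by (apply Rmult_le_pos; lra).
assert (X : 2 * PI * Cmod l <= 2 * PI * ((1 + Cmod l) / 2)).
{ apply B. intros t _. set (z := (2 / (1 + Cmod l) * cos t, 2 / (1 + Cmod l) * sin t) : C).
  assert (Cz : Cmod z = 2 / (1 + Cmod l)) by (apply Cmod_polar; lra).
  eapply Rle_trans; [exact (Rabs_fst_le_Cmod (u * f z / z)) | ].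
  rewrite Cmod_div by (apply Cmod_gt_0; lra). rewrite Cz.
  destruct (Hf' z ltac:(lra)) as [Fz _].
  replace ((1 + Cmod l) / 2) with (1 / (2 / (1 + Cmod l))) by (field; lra).
  apply Rmult_le_compat_r; [left; apply Rinv_0_lt_compat; lra | lra]. }
apply Rmult_le_reg_l in X; lra.
Qed.

(** * Disc automorphisms and the infinitesimal Schwarz-Pick inequality *)

Definition mobius (a z : C) : C := ((z + a) / (1 + Cconj a * z))%C.

Lemma mobius_denominator (a z : C) : Cmod a < 1 -> Cmod z < 1 -> (1 + Cconj a * z)%C <> 0.
Proof.
intros Ha Hz E.
assert (X : Cmod (Cconj a * z) = 1).
{ replace (Cconj a * z)%C with (- (1))%C by (rewrite <- (Cplus_0_r (- (1))), <- E; ring).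
  now rewrite Cmod_opp, Cmod_1. }
rewrite Cmod_mult, Cmod_conj in X.
assert (A := Cmod_ge_0 a). assert (Z := Cmod_ge_0 z). nra.
Qed.

Lemma has_cderiv_mobius (a z : C) : Cmod a < 1 -> Cmod z < 1 ->
  has_cderiv (mobius a) z
    ((1 - a * Cconj a) / ((1 + Cconj a * z) * (1 + Cconj a * z)))%C.
Proof.
intros Ha Hz. assert (N := mobius_denominator a z Ha Hz).
replace (1 - a * Cconj a)%C
  with ((1 + 0) * (1 + Cconj a * z) - (z + a) * (0 + Cconj a * 1))%C by ring.
apply (has_cderiv_div (fun z => z + a)%C (fun z => 1 + Cconj a * z)%C); [ | | exact N].
- apply (has_cderiv_plus (fun z => z) (fun _ => a));
    [apply has_cderiv_id | apply has_cderiv_const].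
- apply (has_cderiv_plus (fun _ => RtoC 1) (fun z => Cconj a * z)%C);
    [apply has_cderiv_const | ].
  apply has_cderiv_scal, has_cderiv_id.
Qed.

(** Rests on the identity [|1 + conj a z|^2 - |z + a|^2 = (1 - |a|^2) (1 - |z|^2)], whose right side
    is positive. *)
Lemma Cmod_mobius_lt (a z : C) : Cmod a < 1 -> Cmod z < 1 -> Cmod (mobius a z) < 1.
Proof.
intros Ha Hz. assert (N := mobius_denominator a z Ha Hz). unfold mobius.
rewrite Cmod_div by exact N. apply Cmod_gt_0 in N.
apply (Rmult_lt_reg_r (Cmod (1 + Cconj a * z))); [exact N | ].
unfold Rdiv. rewrite Rmult_assoc, Rinv_l, Rmult_1_r, Rmult_1_l by lra.
apply Rsqr_incrst_0; try apply Cmod_ge_0. unfold Rsqr.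
assert (E : Cmod (1 + Cconj a * z) ^ 2 - Cmod (z + a) ^ 2
  = (1 - Cmod a ^ 2) * (1 - Cmod z ^ 2)).
{ rewrite !Cmod2_alt. destruct a, z. simpl. ring. }
assert (A := Cmod_ge_0 a). assert (Z := Cmod_ge_0 z).
assert (0 < (1 - Cmod a ^ 2) * (1 - Cmod z ^ 2)) by (apply Rmult_lt_0_compat; nra).
lra.
Qed.

Lemma self_map_mobius (a : C) : Cmod a < 1 -> self_map_of_disc (mobius a).
Proof.
intros Ha z Hz. split; [now apply Cmod_mobius_lt | ].
eexists. now apply has_cderiv_mobius.
Qed.

Lemma mobius_0 (a : C) : mobius a 0 = a.
Proof. unfold mobius. field. Qed.

Lemma mobius_opp_self (a : C) : mobius (- a) a = 0.
Proof. unfold mobius. rewrite Cplus_opp_r. unfold Cdiv. ring. Qed.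

Lemma has_cderiv_mobius_0 (a : C) : Cmod a < 1 ->
  has_cderiv (mobius a) (RtoC 0) (RtoC (1 - Cmod a ^ 2)).
Proof.
intros Ha. assert (Z : Cmod 0 < 1) by (rewrite Cmod_0; lra).
assert (D := has_cderiv_mobius a 0 Ha Z).
rewrite RtoC_minus, Cmod2_conj.
replace (RtoC 1 - a * Cconj a)%C
  with ((1 - a * Cconj a) / ((1 + Cconj a * 0) * (1 + Cconj a * 0)))%C; [exact D | ].
field.
Qed.

Lemma Cmod_opp_lt (a : C) : Cmod a < 1 -> Cmod (- a) < 1.
Proof. now rewrite Cmod_opp. Qed.

Lemma mobius_opp_r (a z : C) : Cmod a < 1 -> Cmod z < 1 -> mobius a (mobius (- a) z) = z.
Proof.
intros Ha Hz. assert (N := mobius_denominator (- a) z (Cmod_opp_lt a Ha) Hz).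
assert (N' := mobius_denominator a _ Ha (Cmod_mobius_lt (- a) z (Cmod_opp_lt a Ha) Hz)).
unfold mobius in *.
assert (E : Cconj (- a) = (- Cconj a)%C) by (apply injective_projections; reflexivity).
rewrite E in *.
assert (Na : (1 - Cconj a * a)%C <> 0).
{ rewrite Cmult_comm, <- Cmod2_conj, <- RtoC_minus. apply RtoC_nonzero.
  assert (A := Cmod_ge_0 a). nra. }
field. split; [exact N | ].
replace (1 + - Cconj a * z + Cconj a * (z + - a))%C with (1 - Cconj a * a)%C by ring.
exact Na.
Qed.

(** With [w = f a], the map [mobius (- w) o f o mobius a] fixes 0 and has derivative
    [l (1 - |a|^2) / (1 - |w|^2)] there, which [schwarz_deriv] bounds. *)
Lemma schwarz_pick_deriv (f : C -> C) (a l : C) :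
  self_map_of_disc f -> Cmod a < 1 -> has_cderiv f a l ->
  Cmod l * (1 - Cmod a ^ 2) <= 1 - Cmod (f a) ^ 2.
Proof.
intros Hf Ha Dl. destruct (Hf a Ha) as [Fa _].
set (w := f a) in *.
assert (W := Cmod_ge_0 w). assert (A := Cmod_ge_0 a).
assert (Wn := Cmod_opp_lt w Fa).
assert (Pw : 0 < 1 - Cmod w ^ 2) by nra. assert (Pa : 0 < 1 - Cmod a ^ 2) by nra.
assert (Dm := has_cderiv_mobius (- w) w Wn Fa).
assert (S := schwarz_deriv (fun z => mobius (- w) (f (mobius a z)))
  ((1 - - w * Cconj (- w)) / ((1 + Cconj (- w) * w) * (1 + Cconj (- w) * w))
    * (l * RtoC (1 - Cmod a ^ 2)))).
assert (E : (1 + Cconj (- w) * w)%C = RtoC (1 - Cmod w ^ 2)).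
{ rewrite RtoC_minus, Cmod2_conj. apply injective_projections; simpl; ring. }
assert (E' : (1 - - w * Cconj (- w))%C = RtoC (1 - Cmod w ^ 2)).
{ rewrite RtoC_minus, Cmod2_conj. apply injective_projections; simpl; ring. }
rewrite E, E' in *.
assert (Nw : RtoC (1 - Cmod w ^ 2) <> 0) by (apply RtoC_nonzero; lra).
rewrite !Cmod_mult, Cmod_div, !Cmod_mult, !Cmod_R, !Rabs_pos_eq in S
  by (try (apply Cmult_neq_0; assumption); lra).
replace ((1 - Cmod w ^ 2) / ((1 - Cmod w ^ 2) * (1 - Cmod w ^ 2)) * (Cmod l * (1 - Cmod a ^ 2)))
  with (Cmod l * (1 - Cmod a ^ 2) / (1 - Cmod w ^ 2)) in S by (field; lra).
apply (Rmult_le_reg_r (/ (1 - Cmod w ^ 2))); [now apply Rinv_0_lt_compat | ].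
rewrite Rinv_r by lra. apply S.
- apply self_map_comp; [now apply self_map_mobius | ].
  apply self_map_comp; [exact Hf | now apply self_map_mobius].
- rewrite mobius_0. apply mobius_opp_self.
- assert (D2 : has_cderiv (fun z => f (mobius a z)) (RtoC 0) (l * RtoC (1 - Cmod a ^ 2))%C).
  { apply has_cderiv_comp; [now rewrite mobius_0 | now apply has_cderiv_mobius_0]. }
  apply (has_cderiv_comp (mobius (- w)) (fun z => f (mobius a z))); [ | exact D2].
  rewrite mobius_0. exact Dm.
Qed.

(** * The finite Schwarz-Pick inequality and the rigidity case of the Schwarz lemma *)

Definition artanh (x : R) : R := / 2 * ln ((1 + x) / (1 - x)).

Lemma artanh_0 : artanh 0 = 0.
Proof. unfold artanh. replace ((1 + 0) / (1 - 0)) with 1 by field. rewrite ln_1. ring. Qed.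

Lemma artanh_increasing (x y : R) : -1 < x < y -> y < 1 -> artanh x < artanh y.
Proof.
intros Hxy Hy. unfold artanh. apply Rmult_lt_compat_l; [lra | ].
apply ln_increasing; [apply Rdiv_lt_0_compat; lra | ].
apply (Rmult_lt_reg_r ((1 - x) * (1 - y))); [apply Rmult_lt_0_compat; lra | ].
replace ((1 + x) / (1 - x) * ((1 - x) * (1 - y))) with ((1 + x) * (1 - y)) by (field; lra).
replace ((1 + y) / (1 - y) * ((1 - x) * (1 - y))) with ((1 + y) * (1 - x)) by (field; lra).
lra.
Qed.

Lemma is_derive_artanh (x : R) : -1 < x < 1 -> is_derive artanh x (/ (1 - x ^ 2)).
Proof.
intros Hx. unfold artanh. auto_derive.
- split; [lra | split; [apply Rdiv_lt_0_compat; lra | exact I]].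
- field. repeat split; nra.
Qed.

Lemma Cmod_lt_1_fst (z : C) : Cmod z < 1 -> -1 < fst z < 1.
Proof. intros H. assert (X := Rabs_fst_le_Cmod z). apply Rabs_le_between in X. lra. Qed.

Lemma fst_sqr_le_Cmod_sqr (z : C) : fst z ^ 2 <= Cmod z ^ 2.
Proof. rewrite Cmod2_alt. unfold Re. assert (X := pow2_ge_0 (Im z)). lra. Qed.

(* The infinitesimal Schwarz-Pick inequality bounds the derivative of
   [artanh (Re (k (s v)))] by that of [artanh s]. *)
Lemma artanh_along_ray (k : C -> C) (v : C) (t : R) :
  self_map_of_disc k -> Cmod v = 1 -> 0 <= t < 1 ->
  artanh (fst (k (t * v)%C)) - artanh (fst (k 0)) <= artanh t.
Proof.
intros Hk Hv Ht.
assert (Cs : forall s, 0 <= s <= t -> Cmod (s * v) = s).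
{ intros s Hs. rewrite Cmod_mult, Cmod_R, Hv, Rabs_pos_eq; lra. }
assert (D : forall s, 0 <= s <= t -> exists d, 0 <= d /\
  is_derive (fun s => artanh s - artanh (fst (k (s * v)%C))) s d).
{ intros s Hs. assert (Cz : Cmod (s * v) < 1) by (rewrite Cs; lra).
  destruct (Hk _ Cz) as [Kz [l Dl]].
  assert (B := Cmod_lt_1_fst _ Kz).
  set (y := fst (k (s * v)%C)) in *.
  exists (/ (1 - s ^ 2) - fst (l * v)%C * / (1 - y ^ 2)). split.
  (* Schwarz-Pick survives passing to the real part: [Re (l v) <= |l|], and
     [1 - |k|^2 <= 1 - y^2]. *)
  - assert (P := schwarz_pick_deriv k _ l Hk Cz Dl). rewrite (Cs s Hs) in P.
    assert (Y := fst_sqr_le_Cmod_sqr (k (s * v)%C)). fold y in Y.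
    assert (L := Rabs_fst_le_Cmod (l * v)). rewrite Cmod_mult, Hv, Rmult_1_r in L.
    apply Rabs_le_between in L.
    assert (P1 : 0 < 1 - s ^ 2) by nra. assert (P2 : 0 < 1 - y ^ 2) by nra.
    replace (/ (1 - s ^ 2) - fst (l * v)%C * / (1 - y ^ 2))
      with ((1 - y ^ 2 - fst (l * v)%C * (1 - s ^ 2)) / ((1 - s ^ 2) * (1 - y ^ 2)))
      by (field; lra).
    apply Rmult_le_pos; [ | left; apply Rinv_0_lt_compat; now apply Rmult_lt_0_compat].
    assert (fst (l * v)%C * (1 - s ^ 2) <= Cmod l * (1 - s ^ 2))
      by (apply Rmult_le_compat_r; lra).
    lra.
  - apply (is_derive_minus (V := R_NormedModule)); [apply is_derive_artanh; lra | ].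
    apply (is_derive_comp (V := R_NormedModule) artanh (fun s : R => fst (k (s * v)%C))).
    + now apply is_derive_artanh.
    + now apply has_cderiv_along_ray. }
set (psi := fun s : R => artanh s - artanh (fst (k (s * v)%C))) in *.
assert (E : forall s, 0 <= s <= t -> 0 <= Derive psi s /\ is_derive psi s (Derive psi s)).
{ intros s Hs. destruct (D s Hs) as [d [Pd Dd]].
  replace (Derive psi s) with d by (symmetry; exact (is_derive_unique psi s d Dd)). tauto. }
destruct (MVT_gen psi 0 t (Derive psi)) as (s & Hs & Es).
- intros s. rewrite Rmin_left, Rmax_right by lra. intros Hs. apply E. lra.
- intros s. rewrite Rmin_left, Rmax_right by lra. intros Hs.
  apply derivable_continuous_pt. exists (Derive psi s). apply is_derive_Reals, E, Hs.
- rewrite Rmin_left, Rmax_right in Hs by lra.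
  assert (0 <= Derive psi s * (t - 0)) by (apply Rmult_le_pos; [apply E; exact Hs | lra]).
  unfold psi in Es at 1 2. rewrite artanh_0, Cmult_0_l in Es. lra.
Qed.

Lemma poincare_dist_mobius (a b : C) : Cmod a < 1 -> Cmod b < 1 ->
  poincare_dist a b = artanh (Cmod (mobius (- a) b)).
Proof.
intros Ha Hb. unfold mobius.
rewrite Cmod_div by (apply mobius_denominator; [now apply Cmod_opp_lt | exact Hb]).
change (artanh (Cmod (a - b) / Cmod (1 - Cconj a * b))
  = artanh (Cmod (b + - a) / Cmod (1 + Cconj (- a) * b))).
rewrite <- (Cmod_opp (a - b)). f_equal. f_equal; f_equal.
- ring.
- apply injective_projections; simpl; ring.
Qed.

(** Precomposing with [mobius a] moves [a] to 0 and [b] to [w], which lies at distance [|w|] on the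
    ray in direction [Cconj u]; then [artanh_along_ray] applies. *)
Lemma schwarz_pick (h : C -> C) (a b : C) :
  self_map_of_disc h -> Cmod a < 1 -> Cmod b < 1 ->
  artanh (fst (h b)) - artanh (fst (h a)) <= poincare_dist a b.
Proof.
intros Hh Ha Hb. rewrite poincare_dist_mobius by assumption.
set (w := mobius (- a) b).
assert (Hw : Cmod w < 1) by (apply Cmod_mobius_lt; [now apply Cmod_opp_lt | exact Hb]).
destruct (exists_conj_phase w) as (u & Hu & Uw).
assert (Ew : w = (Cmod w * Cconj u)%C).
{ rewrite <- Uw. replace (u * w * Cconj u)%C with (u * Cconj u * w)%C by ring.
  rewrite <- Cmod2_conj, Hu. replace (1 ^ 2) with 1 by ring. ring. }
assert (R := artanh_along_ray (fun z => h (mobius a z)) (Cconj u) (Cmod w)).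
assert (Mw : mobius a w = b) by now apply mobius_opp_r.
rewrite <- Ew, mobius_0, Mw in R.
apply R.
- apply self_map_comp; [exact Hh | now apply self_map_mobius].
- now rewrite Cmod_conj.
- split; [apply Cmod_ge_0 | exact Hw].
Qed.

(** This is [schwarz_pick] between 0 and [z], for [f] rotated so that its value at [z] is [|f z|],
    followed by strict monotonicity of [artanh]. *)
Lemma schwarz (f : C -> C) (z : C) :
  self_map_of_disc f -> f 0 = 0 -> Cmod z < 1 -> Cmod (f z) <= Cmod z.
Proof.
intros Hf F0 Hz. apply Rnot_lt_le. intros L. destruct (Hf z Hz) as [Fz _].
destruct (exists_conj_phase (f z)) as (u & Hu & Uf).
assert (Z : Cmod 0 < 1) by (rewrite Cmod_0; lra).
assert (S := schwarz_pick (fun z => u * f z)%C 0 z (self_map_rotate f u Hu Hf) Z Hz).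
rewrite poincare_dist_mobius in S by assumption.
assert (E : mobius (- 0) z = z).
{ unfold mobius. replace (Cconj (- 0)) with (RtoC 0)
    by (apply injective_projections; simpl; ring).
  field. }
rewrite E in S. cbv beta in S. rewrite Uf, F0, Cmult_0_r in S.
change (artanh (Cmod (f z)) - artanh 0 <= artanh (Cmod z)) in S. rewrite artanh_0 in S.
assert (X := artanh_increasing (Cmod z) (Cmod (f z))). assert (Y := Cmod_ge_0 z). lra.
Qed.

(** Continuity makes [g] positive on a short initial interval. Applied to [1 - phi] below, it turns
    equality in the mean into equality at angle 0. *)
Lemma RInt_pos_of_pos_start (g : R -> R) (T : R) : 0 < T ->
  (forall t, 0 <= t <= T -> continuous g t) -> (forall t, 0 <= t <= T -> 0 <= g t) ->
  0 < g 0 -> 0 < RInt g 0 T.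
Proof.
intros HT Cg Pg P0.
assert (C0 := Cg 0 ltac:(lra)). apply continuity_pt_filterlim in C0.
destruct (C0 (g 0) P0) as [d [Hd Hdd]].
set (e := Rmin (d / 2) T).
assert (E1 : e <= d / 2) by apply Rmin_l. assert (E2 : e <= T) by apply Rmin_r.
assert (E0 : 0 < e) by (apply Rmin_pos; lra).
assert (ex : forall a b, 0 <= a <= b -> b <= T -> ex_RInt g a b).
{ intros a b Ha Hb. apply (ex_RInt_continuous (V := R_CompleteNormedModule)).
  intros z. rewrite Rmin_left, Rmax_right by lra. intros Hz. apply Cg. lra. }
rewrite <- (RInt_Chasles (V := R_CompleteNormedModule) g 0 e T) by (apply ex; lra).
apply (Rplus_lt_le_0_compat (RInt g 0 e)).
- apply RInt_gt_0; [exact E0 | | intros; apply Cg; lra].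
  intros x Hx. assert (X : R_dist (g x) (g 0) < g 0).
  { apply Hdd. split; [split; [exact I | lra] | ].
    simpl. unfold R_dist. rewrite Rminus_0_r, Rabs_pos_eq; lra. }
  unfold R_dist in X. apply Rabs_def2 in X. lra.
- apply RInt_ge_0; [lra | apply ex; lra | ]. intros x Hx. apply Pg. lra.
Qed.

(** Conjugating by a rotation places [z] at the positive real point [r] and keeps the derivative 1.
    Then [Re (g x / x)] is at most 1 by [schwarz] and has mean 1 on the circle [|x| = r], so it
    equals 1 at [x = r]. *)
Theorem schwarz_rigidity (f : C -> C) (z : C) :
  self_map_of_disc f -> f 0 = 0 -> has_cderiv f (RtoC 0) (RtoC 1) -> Cmod z < 1 -> f z = z.
Proof.
intros Hf F0 D0 Hz.
destruct (classic (z = 0)) as [-> | Nz]; [exact F0 | ].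
apply Cmod_gt_0 in Nz. set (r := Cmod z) in *.
destruct (exists_conj_phase z) as (u & Hu & Uz). fold r in Uz.
assert (UU : (Cconj u * u)%C = 1).
{ rewrite Cmult_comm, <- Cmod2_conj, Hu. f_equal. ring. }
assert (Ez : (Cconj u * r)%C = z) by (rewrite <- Uz, Cmult_assoc, UU; ring).
set (g := fun x => (u * f (Cconj u * x))%C).
assert (Dr : forall x : C, has_cderiv (fun x => Cconj u * x)%C x (Cconj u)).
{ intros x. assert (D := has_cderiv_scal (Cconj u) _ x _ (has_cderiv_id x)).
  now rewrite Cmult_1_r in D. }
assert (Hg : self_map_of_disc g).
{ apply (self_map_rotate (fun x => f (Cconj u * x)%C)); [exact Hu | ].
  apply (self_map_comp f (fun x => Cconj u * x)%C); [exact Hf | ].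
  intros x Hx. split; [now rewrite Cmod_mult, Cmod_conj, Hu, Rmult_1_l | ].
  now exists (Cconj u). }
assert (G0 : g 0 = 0) by (unfold g; rewrite Cmult_0_r, F0; ring).
assert (GD : has_cderiv g (RtoC 0) (RtoC 1)).
{ replace (RtoC 1) with (u * (1 * Cconj u))%C
    by now rewrite Cmult_1_l, (Cmult_comm u), UU.
  apply (has_cderiv_scal u (fun x => f (Cconj u * x)%C)).
  apply (has_cderiv_comp f (fun x => Cconj u * x)%C); [now rewrite Cmult_0_r | apply Dr]. }
assert (PIpos := PI_RGT_0).
set (phi := fun t => fst (Cdiv (g (r * cos t, r * sin t)) ((r * cos t)%R, (r * sin t)%R))).
assert (M : RInt phi 0 (2 * PI) = 2 * PI * 1).
{ apply (mean_value_quotient g 1 r); try assumption; [ | split; assumption].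
  intros x Hx. apply (Hg x Hx). }
assert (Cq : forall t, Cmod (Cdiv (g (r * cos t, r * sin t)) ((r * cos t)%R, (r * sin t)%R)) <= 1).
{ intros t. set (x := (r * cos t, r * sin t) : C).
  assert (Cx : Cmod x = r) by (apply Cmod_polar; lra).
  change (Cmod (g x / x) <= 1). rewrite Cmod_div by (apply Cmod_gt_0; lra).
  assert (S := schwarz g x Hg G0 ltac:(lra)).
  apply (Rmult_le_reg_r (Cmod x)); [lra | ].
  unfold Rdiv. rewrite Rmult_assoc, Rinv_l; lra. }
assert (Cphi : forall t, continuous phi t).
{ intros t. apply (continuous_circle (fun x => g x / x)%C r t Nz).
  assert (Cx : Cmod (r * cos t, r * sin t) = r) by (apply Cmod_polar; lra).
  destruct (Hg (r * cos t, r * sin t)) as [_ [a Da]]; [lra | ].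
  eexists. apply has_cderiv_div; [exact Da | apply has_cderiv_id | apply Cmod_gt_0; lra]. }
assert (exphi : ex_RInt phi 0 (2 * PI)).
{ apply (ex_RInt_continuous (V := R_CompleteNormedModule)). intros; apply Cphi. }
assert (P1 : 1 <= phi 0).
(* Otherwise [1 - phi], which is nonnegative with integral 0, would be positive at 0. *)
{ apply Rnot_lt_le. intros L.
  assert (Pos : 0 < RInt (fun t => 1 - phi t) 0 (2 * PI)).
  { apply RInt_pos_of_pos_start; [lra | | | lra].
    - intros t _. apply (continuous_minus (V := R_NormedModule) (fun _ => 1) phi);
        [apply continuous_const | apply Cphi].
    - intros t _.
      assert (X := Rabs_fst_le_Cmod
        (Cdiv (g (r * cos t, r * sin t)) ((r * cos t)%R, (r * sin t)%R))).
      assert (Y := Cq t). apply Rabs_le_between in X. fold (phi t) in X. lra. }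
  rewrite (RInt_minus (V := R_CompleteNormedModule) (fun _ => 1) phi) in Pos;
    [ | apply ex_RInt_const | exact exphi].
  rewrite M, RInt_const in Pos. unfold minus, plus, opp, scal in Pos; simpl in Pos.
  unfold mult in Pos; simpl in Pos. lra. }
assert (Q := Cq 0). unfold phi in P1. rewrite cos_0, sin_0, Rmult_1_r, Rmult_0_r in P1, Q.
change (r, 0) with (RtoC r) in P1, Q.
(* A number of modulus at most 1 and real part at least 1 is 1. *)
assert (E : (g r / r)%C = 1).
{ destruct (g r / r)%C as [p q]. simpl in P1.
  assert (S := Cmod2_alt (p, q)). simpl Re in S. simpl Im in S.
  assert (S1 : Cmod (p, q) ^ 2 <= 1).
  { assert (S0 := Cmod_ge_0 (p, q)). nra. }
  apply injective_projections; simpl; nra. }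
assert (Nr : RtoC r <> 0) by (apply RtoC_nonzero; lra).
assert (Gr : g r = r).
{ replace (g r) with (g r / r * r)%C by (field; exact Nr). rewrite E. ring. }
unfold g in Gr. rewrite Ez in Gr. rewrite <- Ez at 2. rewrite <- Gr, Cmult_assoc, UU. ring.
Qed.

(** * Discs with a left inverse *)

(** For each link, [h o fst o F] is a self-map of the disc, so [schwarz_pick] bounds the increment
    of [artanh (Re h)] by the length of that link. The endpoint [p] is generalized because it moves
    along the chain. *)
Lemma kob_chain_length_ge (Om : Cx * Cx -> Prop) (h : C -> C) L p q :
  (forall P, Om P -> Cmod (fst P) < 1) -> self_map_of_disc h -> kob_chain Om p q L ->
  artanh (fst (h (fst q))) - artanh (fst (h (fst p))) <= chain_length L.
Proof.
intros HOm Hh. revert p. induction L as [ | [[F a] b] L IH]; simpl; intros p.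
- intros ->. lra.
- intros ([FO Fd] & Ha & Hb & <- & Hc).
  specialize (IH _ Hc).
  assert (S : self_map_of_disc (fun z => h (fst (F z)))).
  { apply (self_map_comp h (fun z => fst (F z))); [exact Hh | ].
    intros z Hz. split; [apply HOm, FO, Hz | ].
    destruct (Fd z Hz) as [l [Dl _]]. now exists (fst l). }
  assert (X := schwarz_pick _ a b S Ha Hb). cbv beta in X. lra.
Qed.

Section LeftInverse.

Variables (Om : Cx * Cx -> Prop) (F : Cx -> Cx * Cx).
Hypothesis Om_disc : forall P, Om P -> Cmod (fst P) < 1.
Hypothesis F_holo : holo_map Om F.
Hypothesis F_section : forall z : C, Cmod z < 1 -> fst (F z) = z.

Lemma section_complex_geodesic : complex_geodesic Om F.
Proof.
split; [exact F_holo | ]. intros z z' Hz Hz'. split.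
- intros x [L [HL ->]].
  set (w := mobius (- z) z').
  destruct (exists_conj_phase w) as (u & Hu & Uw).
  (* This test function vanishes at [z] and takes the value [|w|] at [z'], so its increment of
     [artanh] is exactly the Poincare distance. *)
  assert (Hh : self_map_of_disc (fun x => u * mobius (- z) x)%C).
  { apply self_map_rotate; [exact Hu | ]. now apply self_map_mobius, Cmod_opp_lt. }
  assert (X := kob_chain_length_ge Om _ L _ _ Om_disc Hh HL). cbv beta in X.
  rewrite !F_section, mobius_opp_self in X by assumption. fold w in X.
  rewrite Uw, Cmult_0_r in X.
  change (artanh (Cmod w) - artanh 0 <= chain_length L) in X. rewrite artanh_0 in X.
  rewrite (poincare_dist_mobius z z') by assumption. fold w. lra.
(* [F] itself is a chain with one link that attains the bound. *)
- intros m Hm. apply Hm. exists ((F, z, z') :: nil). split; [simpl; tauto | simpl; ring].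
Qed.

Lemma section_inf_complex_geodesic : inf_complex_geodesic Om F.
Proof.
split; [exact F_holo | ]. intros z v0 l Hz Dl.
change (Cmod z < 1) in Hz. assert (Z := Cmod_ge_0 z).
assert (Pz : 0 < 1 - Cmod z ^ 2) by nra.
assert (Z0 : Cmod 0 < 1) by (rewrite Cmod_0; lra).
assert (L1 : fst l = RtoC 1).
{ apply (has_cderiv_unique (fun x => x) z); [ | apply has_cderiv_id].
  apply (has_cderiv_ext_disc (fun x => fst (F x))); [exact F_section | exact Hz | apply Dl]. }
unfold poincare_metric. change (Defs.Cmod v0) with (Cmod v0).
change (Defs.Cmod z) with (Cmod z). split.
(* For a competitor [G] through [F z], Schwarz-Pick for [fst o G] at 0 gives
   [|fst l'| <= 1 - |z|^2], while [a * fst l' = v0]. *)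
- intros x (G & a & l' & [GO Gd] & G0 & [Dl' _] & E & ->).
  assert (S : self_map_of_disc (fun z => fst (G z))).
  { intros y Hy. split; [apply Om_disc, GO, Hy | ].
    destruct (Gd y Hy) as [b [Db _]]. now exists (fst b). }
  assert (X := schwarz_pick_deriv _ _ _ S Z0 Dl'). cbv beta in X.
  replace (G (RtoC 0)) with (F z) in X by (symmetry; exact G0).
  rewrite F_section, Cmod_0 in X by exact Hz.
  assert (E1 : (a * fst l')%C = (v0 * fst l)%C) by exact (f_equal fst E).
  rewrite L1, Cmult_1_r in E1. rewrite <- E1, Cmod_mult.
  change (Cmod a * Cmod (fst l') / (1 - Cmod z ^ 2) <= Cmod a).
  apply (Rmult_le_reg_r (1 - Cmod z ^ 2)); [exact Pz | ].
  unfold Rdiv. rewrite Rmult_assoc, Rinv_l, Rmult_1_r by lra.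
  apply Rmult_le_compat_l; [apply Cmod_ge_0 | lra].
- intros m Hm. apply Hm.
  assert (Nz : RtoC (1 - Cmod z ^ 2) <> 0) by (apply RtoC_nonzero; lra).
  destruct F_holo as [FO Fd].
  (* The infimum is attained by [F] recentred at [z]: its derivative at 0 is [(1 - |z|^2) l], which
     forces the scalar [v0 / (1 - |z|^2)]. *)
  exists (fun x => F (mobius z x)), (v0 / RtoC (1 - Cmod z ^ 2))%C,
    (fst l * RtoC (1 - Cmod z ^ 2), snd l * RtoC (1 - Cmod z ^ 2))%C.
  assert (comp : forall x : C, Cmod x < 1 -> forall b d, deriv2 F (mobius z x) b ->
    has_cderiv (mobius z) x d ->
    deriv2 (fun x => F (mobius z x)) x (fst b * d, snd b * d)%C).
  { intros x Hx b d [D1 D2] Dd. split.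
    - now apply (has_cderiv_comp (fun y => fst (F y)) (mobius z)).
    - now apply (has_cderiv_comp (fun y => snd (F y)) (mobius z)). }
  split; [split | repeat split].
  + intros x Hx. now apply FO, Cmod_mobius_lt.
  + intros x Hx. destruct (Fd (mobius z x)) as [b Db]; [now apply Cmod_mobius_lt | ].
    eexists. apply comp; [exact Hx | exact Db | now apply has_cderiv_mobius].
  + change Czero with (RtoC 0). now rewrite mobius_0.
  + apply (comp (RtoC 0) Z0); [now rewrite mobius_0 | now apply has_cderiv_mobius_0].
  + apply (comp (RtoC 0) Z0); [now rewrite mobius_0 | now apply has_cderiv_mobius_0].
  + destruct l as [l1 l2]. unfold Cscal. simpl fst. simpl snd.
    apply injective_projections; simpl fst; simpl snd.
    * change ((v0 / RtoC (1 - Cmod z ^ 2) * (l1 * RtoC (1 - Cmod z ^ 2)))%C = (v0 * l1)%C).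
      field. exact Nz.
    * change ((v0 / RtoC (1 - Cmod z ^ 2) * (l2 * RtoC (1 - Cmod z ^ 2)))%C = (v0 * l2)%C).
      field. exact Nz.
  + change (Cmod v0 / (1 - Cmod z ^ 2) = Cmod (v0 / RtoC (1 - Cmod z ^ 2))).
    rewrite Cmod_div, Cmod_R, Rabs_pos_eq by (assumption || lra). reflexivity.
Qed.

End LeftInverse.

(** * The domain [Omega] and the model discs *)

Lemma one_le_cube (eps : R) : 0 < eps -> 1 <= (1 + eps) ^ 3.
Proof. intros H. apply pow_R1_Rle. lra. Qed.

(** With [a = |z|] and [b = |w|], [rho] is at least [a^2 + b^2 - a^4 b^2 - 1 = (a^2 - 1) (1 - b^2
    (a^2 + 1))]. The bounds [a^2 <= 2] and [b^2 <= 1/16] keep the second factor positive, so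
    [a >= 1] would give [rho >= 0]. *)
Lemma Omega_fst_in_disc (eps : R) (P : Cx * Cx) :
  0 < eps < / 100 -> Omega eps P -> Cmod (fst P) < 1.
Proof.
destruct P as [z w]. intros He (Hr & Hz & Hw). simpl fst in *. simpl snd in *.
change (Cmod z < 1 + eps) in Hz. change (Cmod w < / (4 * (1 + eps) ^ 3)) in Hw.
change (Cmod z ^ 2 + Cmod w ^ 2
  - Re ((Cconj z * Cconj z) * (Cconj z * Cconj z) * (w * w)) - 1 < 0) in Hr.
assert (B := re_le_Cmod ((Cconj z * Cconj z) * (Cconj z * Cconj z) * (w * w))).
apply Rabs_le_between in B. destruct B as [_ B].
rewrite !Cmod_mult, Cmod_conj in B.
assert (K := one_le_cube eps (proj1 He)).
assert (Hw4 : Cmod w < / 4).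
{ eapply Rlt_le_trans; [exact Hw | ]. apply Rinv_le_contravar; lra. }
assert (A := Cmod_ge_0 z). assert (W := Cmod_ge_0 w).
set (a := Cmod z) in *. set (b := Cmod w) in *.
apply Rnot_le_lt. intros L.
assert (Hb : b * b <= / 16) by nra.
assert (Ha : a * a <= 2) by nra.
assert (0 <= (a * a - 1) * (1 - b * b * (a * a + 1))).
{ apply Rmult_le_pos; nra. }
nra.
Qed.

(** On [|t| = 1] the cubic term is [t^4] times the conjugate of the linear one. The parameter [b]
    prescribes the direction [(1, b)] at 0. *)
Definition model_disc (b t : C) : C * C := (t, b * t + Cconj b * (t * (t * t)))%C.

(* On [|t| = 1] the second component [w] of [model_disc b] makes [t^-2 w] real, so
   [rho] vanishes there; this is the resulting factorization inside the disc, with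
   [X + i Y = b * conj t]. *)
Lemma rho_model_disc (b t : C) :
  let s := (fst t ^ 2 + snd t ^ 2)%R in
  let X := (fst b * fst t + snd b * snd t)%R in
  let Y := (snd b * fst t - fst b * snd t)%R in
  rho (model_disc b t) =
  (s - 1) * (1 - ((1 + s) ^ 3 * X ^ 2 + (1 - s) * (1 + s ^ 2) * Y ^ 2)).
Proof.
destruct b as [p q], t as [x y]. intros s X Y. unfold rho, model_disc.
change Defs.Cmod with Cmod. rewrite !Cmod2_alt. unfold s, X, Y. simpl. ring.
Qed.

Lemma holo_model_disc (eps : R) (b : C) : 0 < eps ->
  Cmod b < / (16 * (1 + eps) ^ 3) -> holo_map (Omega eps) (model_disc b).
Proof.
intros He Hb. assert (K := one_le_cube eps He). assert (B := Cmod_ge_0 b). split.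
- intros t Ht. change (Cmod t < 1) in Ht. assert (T := Cmod_ge_0 t). repeat split.
  + assert (B16 : Cmod b < / 16).
    { eapply Rlt_le_trans; [exact Hb | ]. apply Rinv_le_contravar; lra. }
    rewrite rho_model_disc. set (s := fst t ^ 2 + snd t ^ 2).
    set (X := fst b * fst t + snd b * snd t). set (Y := snd b * fst t - fst b * snd t).
    assert (Es : s = Cmod t ^ 2) by (rewrite Cmod2_alt; reflexivity).
    assert (EXY : X ^ 2 + Y ^ 2 = Cmod b ^ 2 * s)
      by (rewrite Cmod2_alt; unfold X, Y, s, Re, Im; ring).
    assert (S0 : 0 <= s) by (rewrite Es; nra). assert (S1 : s < 1) by (rewrite Es; nra).
    assert (X2 := pow2_ge_0 X). assert (Y2 := pow2_ge_0 Y).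
    (* Both coefficients in the factorization are at most 8 and [8 / 256 < 1], so the second factor
       of [rho] is positive while [s - 1] is negative. *)
    assert (XY : X ^ 2 + Y ^ 2 <= / 256) by (rewrite EXY; nra).
    assert (C1 : (1 + s) ^ 3 <= 8).
    { replace 8 with (2 ^ 3) by ring. apply pow_incr. lra. }
    assert (C2 : (1 - s) * (1 + s ^ 2) <= 8) by nra.
    assert ((1 + s) ^ 3 * X ^ 2 <= 8 * X ^ 2) by (apply Rmult_le_compat_r; lra).
    assert ((1 - s) * (1 + s ^ 2) * Y ^ 2 <= 8 * Y ^ 2) by (apply Rmult_le_compat_r; lra).
    nra.
  + change (Cmod t < 1 + eps). lra.
  + change (Cmod (b * t + Cconj b * (t * (t * t))) < / (4 * (1 + eps) ^ 3)).
    eapply Rle_lt_trans; [apply Cmod_triangle | ].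
    rewrite !Cmod_mult, Cmod_conj.
    assert (T3 : Cmod t * (Cmod t * Cmod t) <= 1) by nra.
    assert (M1 : Cmod b * Cmod t <= Cmod b * 1) by (apply Rmult_le_compat_l; lra).
    assert (M2 : Cmod b * (Cmod t * (Cmod t * Cmod t)) <= Cmod b * 1)
      by (apply Rmult_le_compat_l; lra).
    assert (I : 0 < / (16 * (1 + eps) ^ 3)) by (apply Rinv_0_lt_compat; lra).
    (* The second component is at most [2 |b|], and the allowed radius is four times the bound on
       [|b|]. *)
    replace (/ (4 * (1 + eps) ^ 3)) with (4 * / (16 * (1 + eps) ^ 3)) by (field; lra).
    lra.
- intros t _. eexists (_, _). split; [apply has_cderiv_id | ].
  apply (has_cderiv_plus (fun t => b * t)%C (fun t => Cconj b * (t * (t * t)))%C);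
    apply has_cderiv_scal; [apply has_cderiv_id | ].
  apply (has_cderiv_mult (fun t => t) (fun t => t * t)%C); [apply has_cderiv_id | ].
  apply (has_cderiv_mult (fun t => t) (fun t => t)); apply has_cderiv_id.
Qed.

Lemma deriv2_model_disc_0 (b : C) : deriv2 (model_disc b) (RtoC 0) (RtoC 1, b).
Proof.
split; [apply has_cderiv_id | ].
assert (D := has_cderiv_plus (fun t => b * t)%C (fun t => Cconj b * (t * (t * t)))%C
  (RtoC 0) _ _
  (has_cderiv_scal b _ _ _ (has_cderiv_id _))
  (has_cderiv_scal (Cconj b) _ _ _
    (has_cderiv_mult (fun t => t) (fun t => t * t)%C _ _ _ (has_cderiv_id _)
      (has_cderiv_mult (fun t => t) (fun t => t) _ _ _ (has_cderiv_id _) (has_cderiv_id _))))).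
simpl snd. cbv beta in D.
replace (b * 1 + Cconj b * (1 * (0 * 0) + 0 * (1 * 0 + 0 * 1)))%C with b in D by ring.
exact D.
Qed.

(* Coquelicot shadows [RtoC] and [Cmod]. *)
Import Pilot.Defs.

Theorem theorem2p3 (eps : R) (Heps : 0 < eps < / 100)
  (z0 : Cx) (Hz0 : in_disc z0) (Hz0n : z0 <> Czero)
  (c : R) (Hc : 0 <= c < / (16 * (1 + eps) ^ 3))
  (F : Cx -> Cx * Cx)
  (HF : inf_extremal (Omega eps) (Czero, Czero) (Cone, Cmul (RtoC c) z0) F) :
  complex_geodesic (Omega eps) F /\ inf_complex_geodesic (Omega eps) F.
Proof.
destruct HF as (F_holo & F0 & lam & Hlam & [D1 _] & Max).
set (f := fun z : C => fst (F z) : C).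
assert (Om_disc := fun P => Omega_fst_in_disc eps P Heps).
assert (Sf : self_map_of_disc f).
{ destruct F_holo as [FO Fd]. intros z Hz. split; [apply Om_disc, FO, Hz | ].
  destruct (Fd z Hz) as [l [Dl _]]. now exists (fst l). }
assert (f0 : f (Complex.RtoC 0) = Complex.RtoC 0) by exact (f_equal fst F0).
assert (Df : has_cderiv f (Complex.RtoC 0) (Complex.RtoC lam)).
{ replace (Complex.RtoC lam) with (fst (Cscal (RtoC lam) (Cone, Cmul (RtoC c) z0)));
    [exact D1 | ].
  apply injective_projections; simpl; ring. }
assert (lam_le : lam <= 1).
{ assert (X := schwarz_deriv f _ Sf f0 Df). rewrite Cmod_R, Rabs_pos_eq in X; lra. }
assert (lam_ge : 1 <= lam).
{ set (b := Cmult (Complex.RtoC c) z0).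
  assert (Hb : Complex.Cmod b < / (16 * (1 + eps) ^ 3)).
  { unfold b. rewrite Cmod_mult, Cmod_R, Rabs_pos_eq by lra.
    change (Complex.Cmod z0 < 1) in Hz0. assert (Z := Cmod_ge_0 z0). nra. }
  apply (Max (model_disc b)).
  - now apply holo_model_disc.
  - apply injective_projections; [reflexivity | ].
    apply injective_projections; simpl; ring.
  - lra.
  - replace (Cscal (RtoC 1) (Cone, Cmul (RtoC c) z0)) with (Complex.RtoC 1, b).
    + apply deriv2_model_disc_0.
    + apply injective_projections; apply injective_projections; simpl; ring. }
assert (lam = 1) by lra. subst lam.
assert (f_id := fun z : C => schwarz_rigidity f z Sf f0 Df).
split; [now apply section_complex_geodesic | now apply section_inf_complex_geodesic].
Qed.
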